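(* Let $G$ be a finite group that has an AI-automorphism. Then there is a central extension $$1\to B_0(G)\to\tau^\flat(G)\to K(G,3)\to 1.$$
   Context: Conventions: $[g,h]=g^{-1}h^{-1}gh$, $g^h=h^{-1}gh$, and $G'$ is the commutator subgroup. Let $G^\ast$ be an isomorphic copy of $G$ via $g\mapsto g^\ast$, and let $G\star G^\ast$ be the free product. The group $\nu(G)$ is the quotient of $G\star G^\ast$ by the normal closure of all elements $[x,y^\ast]^z[x^z,(y^z)^\ast]^{-1}$ and $[x,y^\ast]^{(z^\ast)}[x^z,(y^z)^\ast]^{-1}$ with $x,y,z\in G$. Put $\nabla(G)=\langle [x,x^\ast]: x\in G\rangle\leq \nu(G)$ and $\tau(G)=\nu(G)/\nabla(G)$. Put $M^\flat(G)=\langle [x,y^\ast]: x,y\in G,\ [x,y]=1\rangle\leq \tau(G)$ and $\tau^\flat(G)=\tau(G)/M^\flat(G)$. $B_0(G)$ denotes the Bogomolov multiplier of $G$, i.e. the subgroup of $H^2(G,\mathbb{Q}/\mathbb{Z})$ of classes whose restriction to every abelian subgroup of $G$ is trivial; it is known that $B_0(G)\cong(\ker\kappa)/M^\flat(G)$, where $\kappa\colon[G,G^\ast]_{\tau(G)}\to G'$, $[g,h^\ast]\mapsto[g,h]$, is the commutator map. $K(G,n)=\{(g_1,\ldots,g_n)\in G^n: g_1\cdots g_n\in G'\}$. An AI-automorphism of $G$ is an automorphism of $G$ that induces the inversion automorphism on the abelianisation $G/G'$. *)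

(* Defs.v *)
From HB Require Import structures.
From mathcomp Require Import all_boot all_order all_algebra all_fingroup.
From mathcomp Require Import all_solvable.
From mathcomp Require Import boolp.

Set Implicit Arguments.
Unset Strict Implicit.
Unset Printing Implicit Defensive.

Import GRing.Theory.
Local Notation repr := generic_quotient.repr.
Local Open Scope quotient_scope.
Local Open Scope group_scope.

(* Subgroups and quotients of possibly infinite groups: [groupType] carries no
   subgroup theory, and nu(G) is not finite by construction. *)

Section Subgroups.
Variable X : groupType.

Definition is_subgroup (H : X -> Prop) : Prop :=
  H 1 /\ forall x y, H x -> H y -> H (x * y^-1).

Definition is_normal (H : X -> Prop) : Prop :=
  is_subgroup H /\ forall x z, H x -> H (x ^ z).

Definition gen (S : X -> Prop) : X -> Prop := fun x =>
  forall H : X -> Prop, is_subgroup H -> (forall s, S s -> H s) -> H x.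

Definition conjugates (S : X -> Prop) : X -> Prop :=
  fun t => exists s z, S s /\ t = s ^ z.

Definition normal_closure (S : X -> Prop) : X -> Prop := gen (conjugates S).

Lemma gen_subgroup (S : X -> Prop) : is_subgroup (gen S).
Proof.
split=> [H [] // | x y Sx Sy H HH HS].
by apply: HH.2; [exact: Sx | exact: Sy].
Qed.

Lemma subset_gen (S : X -> Prop) : forall s, S s -> gen S s.
Proof. by move=> s Ss H _; apply. Qed.

Lemma gen_min (S H : X -> Prop) : is_subgroup H -> (forall s, S s -> H s) -> forall x, gen S x -> H x.
Proof. by move=> HH SH x; apply. Qed.

Lemma gen_normal (S : X -> Prop) :
  (forall s z, S s -> S (s ^ z)) -> is_normal (gen S).
Proof.
move=> SJ; split=> [|x z Sx]; first exact: gen_subgroup.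
apply: (@gen_min S (fun y => gen S (y ^ z))) Sx => [|s Ss /=].
  split=> [|u v /= Su Sv]; first by rewrite /= conj1g; have [] := gen_subgroup S.
  by rewrite conjMg conjVg; apply: (gen_subgroup S).2.
by apply: subset_gen; apply: SJ.
Qed.

Lemma normal_closure_normal (S : X -> Prop) : is_normal (normal_closure S).
Proof.
by apply: gen_normal => _ z [s [y [Ss ->]]]; exists s, (y * z); rewrite conjgM.
Qed.

Record normal_subgroup := NormalSubgroup {
  nsub_set :> X -> Prop;
  nsubP : is_normal nsub_set
}.

End Subgroups.

Section Quotient.
Variables (X : groupType) (N : normal_subgroup X).

Let N1 : N 1 := (nsubP N).1.1.
Let NF x y : N x -> N y -> N (x * y^-1) := @proj2 _ _ (nsubP N).1 x y.
Let NJ x z : N x -> N (x ^ z) := @proj2 _ _ (nsubP N) x z.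
Let NV x : N x -> N x^-1.
Proof. by move=> Nx; rewrite -[x^-1]mul1g; apply: NF. Qed.
Let NM x y : N x -> N y -> N (x * y).
Proof. by move=> Nx Ny; rewrite -[y]invgK; apply/NF/NV. Qed.

Definition qrel : rel X := fun x y => `[< N (x^-1 * y) >].

Lemma qrel_equiv : equiv_class_of qrel.
Proof.
split=> [x|x y|y x z]; first by apply/asboolP; rewrite mulVg.
  by apply/asbool_equiv_eq; split=> /NV; rewrite invgM invgK.
move=> /asboolP Nxy /asboolP Nyz; apply/asboolP.
by rewrite -[z](mulKVg y) mulgA; apply: NM.
Qed.

Canonical qrel_equiv_rel := EquivRelPack qrel_equiv.

Definition quotg : Type := {eq_quot qrel}.
HB.instance Definition _ := EqQuotient.on quotg.
HB.instance Definition _ := Choice.on quotg.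

Definition qproj (x : X) : quotg := \pi_quotg x.

Lemma qprojP x y : qproj x = qproj y <-> N (x^-1 * y).
Proof.
by split=> [/eqquotP /asboolP|Nxy]; last apply/eqquotP/asboolP.
Qed.

Lemma qproj_repr (u : quotg) : qproj (repr u) = u.
Proof. exact: reprK. Qed.

Definition qone : quotg := qproj 1.
Definition qinv (u : quotg) : quotg := qproj (repr u)^-1.
Definition qmul (u v : quotg) : quotg := qproj (repr u * repr v).

Lemma qmulE x y : qmul (qproj x) (qproj y) = qproj (x * y).
Proof.
have /qprojP Nx := qproj_repr (qproj x); have /qprojP Ny := qproj_repr (qproj y).
apply/qprojP; move: (repr (qproj x)) (repr (qproj y)) Nx Ny => a b Na Nb.
have -> : (a * b)^-1 * (x * y) = (a^-1 * x) ^ b * (b^-1 * y).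
  by rewrite /conjg invgM !mulgA mulgK.
by apply: NM => //; apply: NJ.
Qed.

Lemma qinvE x : qinv (qproj x) = qproj x^-1.
Proof.
have /qprojP Nx := qproj_repr (qproj x).
apply/qprojP; move: (repr _) Nx => a Na.
have -> : a^-1^-1 * x^-1 = ((a^-1 * x)^-1) ^ a^-1.
  by rewrite /conjg !invgM !invgK !mulgA mulgK.
by apply/NJ/NV.
Qed.

Lemma qmulA : associative qmul.
Proof.
move=> u v w; rewrite -(qproj_repr u) -(qproj_repr v) -(qproj_repr w).
by rewrite !qmulE mulgA.
Qed.
Lemma qmul1 : left_id qone qmul.
Proof. by move=> u; rewrite -(qproj_repr u) qmulE mul1g. Qed.
Lemma qmulg1 : right_id qone qmul.
Proof. by move=> u; rewrite -(qproj_repr u) qmulE mulg1. Qed.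
Lemma qmulV : left_inverse qone qinv qmul.
Proof. by move=> u; rewrite -(qproj_repr u) qinvE qmulE mulVg. Qed.
Lemma qmulgV : right_inverse qone qinv qmul.
Proof. by move=> u; rewrite -(qproj_repr u) qinvE qmulE mulgV. Qed.

HB.instance Definition _ :=
  isGroup.Build quotg qmulA qmul1 qmulg1 qmulV qmulgV.

Lemma qproj_morph : {morph qproj : x y / x * y}.
Proof. by move=> x y; rewrite -qmulE. Qed.

HB.instance Definition _ :=
  isUMagmaMorphism.Build X quotg qproj (erefl, qproj_morph).

End Quotient.

Section FreeProduct.
Variables A B : groupType.

Inductive fprel : seq (A + B) -> seq (A + B) -> Prop :=
| fprel_refl w : fprel w w
| fprel_sym w1 w2 : fprel w1 w2 -> fprel w2 w1
| fprel_trans w1 w2 w3 : fprel w1 w2 -> fprel w2 w3 -> fprel w1 w3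
| fprel_cat u1 u2 v1 v2 :
    fprel u1 u2 -> fprel v1 v2 -> fprel (u1 ++ v1) (u2 ++ v2)
| fprel_1l : fprel [:: inl 1] [::]
| fprel_1r : fprel [:: inr 1] [::]
| fprel_Ml a b : fprel [:: inl a; inl b] [:: inl (a * b)]
| fprel_Mr a b : fprel [:: inr a; inr b] [:: inr (a * b)].

Definition fpeq : rel (seq (A + B)) := fun u v => `[< fprel u v >].

Lemma fpeq_equiv : equiv_class_of fpeq.
Proof.
split=> [w|u v|v u w]; first by apply/asboolP/fprel_refl.
  by apply/asbool_equiv_eq; split=> /fprel_sym.
by move=> /asboolP uv /asboolP vw; apply/asboolP/(fprel_trans uv vw).
Qed.

Canonical fpeq_equiv_rel := EquivRelPack fpeq_equiv.

Definition free_product : Type := {eq_quot fpeq}.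
HB.instance Definition _ := EqQuotient.on free_product.
HB.instance Definition _ := Choice.on free_product.

Definition fpword (w : seq (A + B)) : free_product := \pi_free_product w.

Lemma fpwordP u v : fpword u = fpword v <-> fprel u v.
Proof. by split=> [/eqquotP /asboolP|uv]; last apply/eqquotP/asboolP. Qed.

Lemma fpword_repr (u : free_product) : fpword (repr u) = u.
Proof. exact: reprK. Qed.

Definition letter_inv (x : A + B) : A + B :=
  match x with inl a => inl a^-1 | inr b => inr b^-1 end.
Definition word_inv (w : seq (A + B)) := rev (map letter_inv w).

Lemma letter_invK : involutive letter_inv.
Proof. by case=> x /=; rewrite invgK. Qed.

Lemma word_invK : involutive word_inv.
Proof. by move=> w; rewrite /word_inv map_rev revK mapK //; exact: letter_invK. Qed.

Lemma word_mulV w : fprel (word_inv w ++ w) [::].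
Proof.
elim: w => [|x w IHw]; first exact: fprel_refl.
rewrite /word_inv /= rev_cons cat_rcons.
apply: fprel_trans (IHw); apply: fprel_cat; first exact: fprel_refl.
rewrite -[w in X in fprel _ X]cat0s -cat1s -[x :: w]cat1s catA.
apply: fprel_cat; last exact: fprel_refl.
by case: x => x /=; [apply: fprel_trans (fprel_Ml _ _) _ |
  apply: fprel_trans (fprel_Mr _ _) _]; rewrite mulVg; constructor.
Qed.

Lemma word_inv_cong u v : fprel u v -> fprel (word_inv u) (word_inv v).
Proof.
move=> uv.
have h1 : fprel (word_inv u ++ v) [::].
  apply: fprel_trans (word_mulV u).
  by apply: fprel_cat; [exact: fprel_refl | exact: fprel_sym].
have h2 : fprel (v ++ word_inv v) [::].
  by have := word_mulV (word_inv v); rewrite word_invK.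
have h3 := fprel_cat (fprel_refl (word_inv u)) (fprel_sym h2).
have h4 := fprel_cat h1 (fprel_refl (word_inv v)).
by rewrite cats0 catA in h3; exact: fprel_trans h3 h4.
Qed.

Definition fpone : free_product := fpword [::].
Definition fpinv (u : free_product) := fpword (word_inv (repr u)).
Definition fpmul (u v : free_product) := fpword (repr u ++ repr v).

Lemma fpmulE u v : fpmul (fpword u) (fpword v) = fpword (u ++ v).
Proof. by apply/fpwordP; apply: fprel_cat; apply/fpwordP/fpword_repr. Qed.

Lemma fpinvE u : fpinv (fpword u) = fpword (word_inv u).
Proof. by apply/fpwordP/word_inv_cong/fpwordP/fpword_repr. Qed.

Lemma fpmulA : associative fpmul.
Proof.
move=> u v w; rewrite -(fpword_repr u) -(fpword_repr v) -(fpword_repr w).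
by rewrite !fpmulE catA.
Qed.
Lemma fpmul1 : left_id fpone fpmul.
Proof. by move=> u; rewrite -(fpword_repr u) fpmulE. Qed.
Lemma fpmulg1 : right_id fpone fpmul.
Proof. by move=> u; rewrite -(fpword_repr u) fpmulE cats0. Qed.
Lemma fpmulV : left_inverse fpone fpinv fpmul.
Proof.
by move=> u; rewrite -(fpword_repr u) fpinvE fpmulE; apply/fpwordP/word_mulV.
Qed.
Lemma fpmulgV : right_inverse fpone fpinv fpmul.
Proof.
move=> u; rewrite -(fpword_repr u) fpinvE fpmulE; apply/fpwordP.
by have := word_mulV (word_inv (repr u)); rewrite word_invK.
Qed.

HB.instance Definition _ :=
  isGroup.Build free_product fpmulA fpmul1 fpmulg1 fpmulV fpmulgV.

Definition fpl (a : A) : free_product := fpword [:: inl a].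
Definition fpr (b : B) : free_product := fpword [:: inr b].

Lemma fplM : {morph fpl : x y / x * y}.
Proof.
move=> x y; rewrite [RHS]fpmulE.
by apply/fpwordP/fprel_sym/fprel_Ml.
Qed.
Lemma fprM : {morph fpr : x y / x * y}.
Proof.
move=> x y; rewrite [RHS]fpmulE.
by apply/fpwordP/fprel_sym/fprel_Mr.
Qed.

Lemma fpl1 : fpl 1 = 1.
Proof. by apply/fpwordP; exact: fprel_1l. Qed.
Lemma fpr1 : fpr 1 = 1.
Proof. by apply/fpwordP; exact: fprel_1r. Qed.

HB.instance Definition _ :=
  isUMagmaMorphism.Build A free_product fpl (fpl1, fplM).
HB.instance Definition _ :=
  isUMagmaMorphism.Build B free_product fpr (fpr1, fprM).

Lemma free_product_ind (P : free_product -> Prop) :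
  P 1 -> (forall a u, P u -> P (fpl a * u)) ->
  (forall b u, P u -> P (fpr b * u)) -> forall u, P u.
Proof.
move=> P1 Pl Pr u; rewrite -(fpword_repr u).
elim: (repr u) => [|[a|b] w IHw] //.
- by rewrite -cat1s -fpmulE; exact: Pl.
- by rewrite -cat1s -fpmulE; exact: Pr.
Qed.

End FreeProduct.

Section NonabelianTensor.
Variable G : finGroupType.

(* The copy G^* of G is G itself, included on the right: [gl x] is x and
   [gr x] is x^* in the free product. *)
Notation fpGG := (free_product G G).
Notation gl := (@fpl G G).
Notation gr := (@fpr G G).

Definition nu_relators : fpGG -> Prop :=
  fun t => exists x y z : G,
     t = [~ gl x, gr y] ^ gl z * [~ gl (x ^ z), gr (y ^ z)]^-1 \/
     t = [~ gl x, gr y] ^ gr z * [~ gl (x ^ z), gr (y ^ z)]^-1.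

Definition nu_kernel := NormalSubgroup (normal_closure_normal nu_relators).
Definition nu : groupType := quotg nu_kernel.

Definition nul (x : G) : nu := qproj nu_kernel (gl x).
Definition nur (x : G) : nu := qproj nu_kernel (gr x).

Lemma nu_relE (s t : fpGG) :
  nu_relators (s * t^-1) -> qproj nu_kernel s = qproj nu_kernel t.
Proof.
move=> st; apply/esym/qprojP.
have : nu_kernel ((s * t^-1) ^ t).
  apply: (nsubP nu_kernel).2.
  by apply: subset_gen; exists (s * t^-1), 1; rewrite conjg1.
by rewrite /conjg mulgVK.
Qed.

Lemma nu_conjl x y z : [~ nul x, nur y] ^ nul z = [~ nul (x ^ z), nur (y ^ z)].
Proof.
rewrite /nul /nur -!gmulfR -gmulfJ; apply: nu_relE.
by exists x, y, z; left.
Qed.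

Lemma nu_conjr x y z : [~ nul x, nur y] ^ nur z = [~ nul (x ^ z), nur (y ^ z)].
Proof.
rewrite /nul /nur -!gmulfR -gmulfJ; apply: nu_relE.
by exists x, y, z; right.
Qed.

Lemma nu_ind (P : nu -> Prop) :
  P 1 -> (forall a u, P u -> P (nul a * u)) ->
  (forall b u, P u -> P (nur b * u)) -> forall u, P u.
Proof.
move=> P1 Pl Pr u; rewrite -(qproj_repr u); move: (repr u).
apply: free_product_ind => [|a w Pw|b w Pw].
- by rewrite gmulf1.
- by rewrite gmulfM; exact: Pl.
- by rewrite gmulfM; exact: Pr.
Qed.

Definition nabla_gens : nu -> Prop := fun t => exists x : G, t = [~ nul x, nur x].

Lemma nabla_normal : is_normal (gen nabla_gens).
Proof.
apply: gen_normal => s z; elim/nu_ind: z s => [|a u IHu|b u IHu] _ [x ->].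
- by rewrite conjg1; exists x.
- by rewrite conjgM nu_conjl; apply: IHu; exists (x ^ a).
- by rewrite conjgM nu_conjr; apply: IHu; exists (x ^ b).
Qed.

Definition nabla := NormalSubgroup nabla_normal.
Definition tau : groupType := quotg nabla.

Definition taul (x : G) : tau := qproj nabla (nul x).
Definition taur (x : G) : tau := qproj nabla (nur x).

Lemma tau_conjl x y z :
  [~ taul x, taur y] ^ taul z = [~ taul (x ^ z), taur (y ^ z)].
Proof.
have := congr1 (qproj nabla) (nu_conjl x y z).
by rewrite gmulfJ (gmulfR _ (nul x)) (gmulfR _ (nul (x ^ z))).
Qed.

Lemma tau_conjr x y z :
  [~ taul x, taur y] ^ taur z = [~ taul (x ^ z), taur (y ^ z)].
Proof.
have := congr1 (qproj nabla) (nu_conjr x y z).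
by rewrite gmulfJ (gmulfR _ (nul x)) (gmulfR _ (nul (x ^ z))).
Qed.

Definition Mflat_gens : tau -> Prop :=
  fun t => exists x y : G, [~ x, y] = 1 /\ t = [~ taul x, taur y].

Lemma Mflat_normal : is_normal (gen Mflat_gens).
Proof.
apply: gen_normal => s z; rewrite -(qproj_repr z); move: (repr z) => {}z.
elim/nu_ind: z s => [|a u IHu|b u IHu] _ [x [y [xy1 ->]]].
- by rewrite gmulf1 conjg1; exists x, y.
- rewrite gmulfM conjgM tau_conjl.
  by apply: IHu; exists (x ^ a), (y ^ a); rewrite -conjRg xy1 conj1g.
- rewrite gmulfM conjgM tau_conjr.
  by apply: IHu; exists (x ^ b), (y ^ b); rewrite -conjRg xy1 conj1g.
Qed.

Definition Mflat := NormalSubgroup Mflat_normal.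
Definition tauflat : groupType := quotg Mflat.

End NonabelianTensor.

Section KGroup.
Variables (G : finGroupType) (n : nat).

Definition inK : {pred {ffun 'I_n -> G}} :=
  [pred g : {ffun 'I_n -> G} | \prod_(i < n) g i \in [set: G]^`(1)].

Lemma inK_group_closed : group_closed inK.
Proof.
have nD (x : G) : x \in 'N([set: G]^`(1)).
  by apply: (subsetP (normal_norm (der_normal 1 [set: G]))); rewrite inE.
have cD (g : {ffun 'I_n -> G}) :
    (g \in inK) = (\prod_(i < n) coset [set: G]^`(1) (g i) == 1).
  have <- : coset [set: G]^`(1) (\prod_(i < n) g i)
          = \prod_(i < n) coset [set: G]^`(1) (g i).
    by rewrite -morph_prod // => i _; exact: nD.
  rewrite inE; apply/idP/eqP => [/coset_id // | ]; exact: coset_idr.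
have abD (x y : G) :
    commute (coset [set: G]^`(1) x) (coset [set: G]^`(1) y).
  have /centsP abQ : abelian ([set: G] / [set: G]^`(1)) by exact: der_abelian.
  by apply: abQ; rewrite mem_quotient ?inE.
have cM (f g : {ffun 'I_n -> G}) :
    \prod_(i < n) coset [set: G]^`(1) ((f * g) i)
    = (\prod_(i < n) coset [set: G]^`(1) (f i)) *
      (\prod_(i < n) coset [set: G]^`(1) (g i)).
  elim: (index_enum _) => [|i r IHr]; first by rewrite !big_nil mulg1.
  rewrite !big_cons {}IHr ffunE morphM ?nD // -!mulgA; congr (_ * _).
  rewrite !mulgA; congr (_ * _).
  elim: r => [|j r IHr]; first by rewrite big_nil mulg1 mul1g.
  by rewrite !big_cons mulgA abD -!mulgA IHr.
have inK1 : 1 \in inK by rewrite cD big1 // => i _; rewrite ffunE morph1.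
have inKV g : g \in inK -> g^-1 \in inK.
  rewrite !cD => /eqP g1; have := cM g^-1 g; rewrite mulVg g1 mulg1.
  by move=> <-; rewrite -cD.
split=> // f g fK gK; rewrite cD cM.
by move: fK (inKV _ gK); rewrite !cD => /eqP -> /eqP ->; rewrite mulg1.
Qed.

Definition K : Type := {g : {ffun 'I_n -> G} | inK g}.
HB.instance Definition _ := [isSub of K for @sval _ _].
HB.instance Definition _ := [Choice of K by <:].
HB.instance Definition _ :=
  SubChoice_isSubGroup.Build {ffun 'I_n -> G} inK K inK_group_closed.

End KGroup.

Local Open Scope ring_scope.

Definition int_rat : {pred rat} := [pred q | q \is a Num.int].

Lemma int_rat_closed : zmod_closed int_rat.
Proof. by split=> [|x y]; [exact: rpred0 | exact: rpredB]. Qed.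

HB.instance Definition _ := GRing.isZmodClosed.Build rat int_rat int_rat_closed.

Definition QZ : zmodType := Quotient.quot int_rat.

(* Inhomogeneous cochains with coefficients in the trivial module Q/Z. *)
Section Cohomology.
Variable G : finGroupType.

Definition cocycle : {pred {ffun G * G -> QZ}} :=
  fun f => [forall x : G, forall y : G, forall z : G,
    f (y, z) - f ((x * y)%g, z) + f (x, (y * z)%g) - f (x, y) == 0].

Lemma cocycle_closed : zmod_closed cocycle.
Proof.
split=> [|f g /'forall_'forall_'forall_eqP f0 /'forall_'forall_'forall_eqP g0].
  by apply/'forall_'forall_'forall_eqP => x y z; rewrite !ffunE !subr0 addr0.
apply/'forall_'forall_'forall_eqP => x y z; rewrite !ffunE.
rewrite -[RHS](subr0 0) -[X in _ = X - _](f0 x y z) -[X in _ = _ - X](g0 x y z).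
rewrite !opprD !opprK; rewrite [in RHS]addrACA; congr (_ + _).
rewrite [in RHS]addrACA; congr (_ + _).
by rewrite [in RHS]addrACA.
Qed.

Definition Z2 : Type := {f : {ffun G * G -> QZ} | cocycle f}.
HB.instance Definition _ := [isSub of Z2 for @sval _ _].
HB.instance Definition _ := [Choice of Z2 by <:].
HB.instance Definition _ :=
  GRing.SubChoice_isSubZmodule.Build {ffun G * G -> QZ} cocycle Z2
    cocycle_closed.

Definition coboundary : {pred Z2} := fun f =>
  `[< exists c : G -> QZ,
        forall x y : G, val f (x, y) = c y - c (x * y)%g + c x >].

Lemma coboundary_closed : zmod_closed coboundary.
Proof.
split=> [|f g /asboolP[c fc] /asboolP[d gd]]; apply/asboolP.
  by exists (fun=> 0) => x y; rewrite raddf0 ffunE subr0 addr0.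
exists (fun x => c x - d x) => x y; rewrite raddfB !ffunE fc gd.
by rewrite !opprD !opprK addrACA; congr (_ + _); rewrite addrACA.
Qed.

HB.instance Definition _ :=
  GRing.isZmodClosed.Build Z2 coboundary coboundary_closed.

Definition H2 : zmodType := Quotient.quot coboundary.
Definition H2class (f : Z2) : H2 := \pi_(Quotient.quot coboundary) f.

Lemma H2class_eq (f g : Z2) : H2class f = H2class g <-> f - g \in coboundary.
Proof. by rewrite Quotient.idealrBE; split=> [fg|/eqP //]; apply/eqP. Qed.

Lemma H2class_zmod_morphism : zmod_morphism H2class.
Proof. exact: raddfB. Qed.

HB.instance Definition _ :=
  GRing.isZmodMorphism.Build Z2 H2 H2class H2class_zmod_morphism.

Lemma H2class_repr (c : H2) : H2class (repr c) = c.
Proof. exact: reprK. Qed.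

End Cohomology.

Section Restriction.
Variables (G : finGroupType) (A : {group G}).

Definition res_cochain (f : {ffun G * G -> QZ}) :
    {ffun subg_of A * subg_of A -> QZ} :=
  [ffun u => f (sgval u.1, sgval u.2)].

Lemma res_cocycle (f : Z2 G) : cocycle (res_cochain (val f)).
Proof.
apply/'forall_'forall_'forall_eqP => x y z; rewrite !ffunE /=.
exact: ('forall_'forall_'forall_eqP (valP f)).
Qed.

Definition resZ2 (f : Z2 G) : Z2 (subg_of A) := Sub (res_cochain (val f)) (res_cocycle f).

Lemma resZ2_zmod_morphism : zmod_morphism resZ2.
Proof.
by move=> f g; apply: val_inj; apply/ffunP => u; rewrite !raddfB !ffunE.
Qed.

HB.instance Definition _ :=
  GRing.isZmodMorphism.Build (Z2 G) (Z2 (subg_of A)) resZ2 resZ2_zmod_morphism.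

Definition res (c : H2 G) : H2 (subg_of A) := H2class (resZ2 (repr c)).

Lemma resE (f : Z2 G) : res (H2class f) = H2class (resZ2 f).
Proof.
apply/H2class_eq; rewrite -raddfB.
have /H2class_eq /asboolP[c hc] := H2class_repr (H2class f).
apply/asboolP; exists (fun u => c (sgval u)) => x y.
by rewrite ffunE /= hc.
Qed.

Lemma res_zmod_morphism : zmod_morphism res.
Proof.
move=> a b; rewrite -(H2class_repr a) -(H2class_repr b) -raddfB !resE.
by rewrite !raddfB.
Qed.

HB.instance Definition _ :=
  GRing.isZmodMorphism.Build (H2 G) (H2 (subg_of A)) res res_zmod_morphism.

End Restriction.

Section Bogomolov.
Variable G : finGroupType.

Definition bogomolov : {pred H2 G} :=
  fun c => [forall A : {group G}, abelian A ==> (res A c == 0)].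

Lemma bogomolov_closed : zmod_closed bogomolov.
Proof.
split=> [|c d /'forall_implyP c0 /'forall_implyP d0].
  by apply/'forall_implyP => A _; rewrite raddf0.
apply/'forall_implyP => A abA.
have -> : res A (c - d) = res A c - res A d by exact: raddfB.
by rewrite (eqP (c0 A abA)) (eqP (d0 A abA)) subr0.
Qed.

Definition B0 : Type := {c : H2 G | bogomolov c}.
HB.instance Definition _ := [isSub of B0 for @sval _ _].
HB.instance Definition _ := [Choice of B0 by <:].
HB.instance Definition _ :=
  GRing.SubChoice_isSubZmodule.Build (H2 G) bogomolov B0 bogomolov_closed.

End Bogomolov.

Local Open Scope group_scope.

Definition AI_automorphism (G : finGroupType) (alpha : {perm G}) : Prop :=
  alpha \in Aut [set: G] /\
  forall g : G, coset [set: G]^`(1) (alpha g) = (coset [set: G]^`(1) g)^-1.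

Record central_extension (A : zmodType) (E Q : groupType)
    (i : A -> E) (p : E -> Q) : Prop := CentralExtension {
  ext_iD : {morph i : a b / (a + b)%R >-> a * b};
  ext_pM : {morph p : x y / x * y};
  ext_inj : injective i;
  ext_surj : forall q, exists e, p e = q;
  ext_exact : forall e, p e = 1 <-> exists a, i a = e;
  ext_central : forall a e, commute (i a) e
}.

(* Main.v *)
Require Import Defs.
From HB Require Import structures.
From mathcomp Require Import all_boot all_order all_algebra all_fingroup.
From mathcomp Require Import all_solvable.
From mathcomp Require Import boolp.
From mathcomp Require classical_sets.

(** Write E for tau^flat(G), l and r for the two maps G -> E, and
    c(x, y) = [l x, r y]. There are three homomorphisms E -> G: the folding
    map mu (l x |-> x, r y |-> y) and the two projections. If alpha is an
    AI-automorphism, e |-> (pr1 e, pr2 e, alpha (mu e)) maps E onto K(G, 3),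
    because x alpha(x) lies in G' and the subgroup T generated by the c(x, y)
    maps onto 1 x 1 x G' (lemmas [K_coord_inK], [K_map_surj]). The kernel B
    consists of the t in T with mu t = 1. An element of T acts on T and on l(G)
    by conjugation as r (mu t) does ([tfT_conj_fold], [tfl_conj_fold]), whence
    B is central ([tf3_ker_central]).

    It remains to identify B with the Bogomolov multiplier B_0(G). Let f be a
    normalized 2-cocycle with f(x, y) = f(y, x) for commuting x and y; these are
    the cocycles of the classes in B_0(G) ([bogomolov_sym]). The central
    extension of G^3 by Q/Z with cocycle f(1) - f(2) - f(3) splits over
    {(x, x, 1)} and {(x, 1, x)}, so that E maps to it with l x |-> (x, x, 1) and
    r y |-> (y, 1, y). On B this map takes values in Q/Z, which gives a pairing
    between B_0(G) and B. The pairing is nondegenerate on both sides: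

    - If f pairs trivially with B, the commutator subgroup of the extension of G
      with cocycle f meets Q/Z trivially; as Q/Z is injective
      ([QZ_injective]), the extension splits ([tfchar_ker_split]).

    - If b in B is not 1, one needs a cocycle f that pairs nontrivially with b.
      The group T, with mu : T -> G and the c(x, y), is a
      [commutator_cover]: the commutator of two elements is determined by their
      images in G through c. Such a cover M extends to a semidirect product of a
      cyclic subgroup <g> of G and M, where g acts by m |-> m c(d m, g). Doing
      this for all g in G gives a central extension M of G that contains T
      ([cover_exists]). A character of the kernel of M -> G that does not
      vanish at b transforms the factor set of M into f
      ([tfchar_separates]).

    Finally B_0(G) is finite ([B0_finite]), since a class is represented by a
    cocycle with values in the |G|-torsion of Q/Z, and a nondegenerate pairing
    with a finite abelian group yields an isomorphism, because the dual of a
    finite abelian group embeds into that group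
    ([dual_embedding], [finite_pairing_iso]). *)

Set Implicit Arguments.
Unset Strict Implicit.
Unset Printing Implicit Defensive.

Import Order.TTheory GRing.Theory Num.Theory.
Local Open Scope group_scope.

(** * Generated subgroups and universal properties *)

Section Gen.
Variables (X : groupType) (S : X -> Prop).

Lemma sgen1 : gen S 1. Proof. by have [] := gen_subgroup S. Qed.
Lemma sgenF x y : gen S x -> gen S y -> gen S (x * y^-1).
Proof. exact: (gen_subgroup S).2. Qed.
Lemma sgenV x : gen S x -> gen S x^-1.
Proof. by move=> Sx; rewrite -[x^-1]mul1g; exact: sgenF sgen1 Sx. Qed.
Lemma sgenM x y : gen S x -> gen S y -> gen S (x * y).
Proof. by move=> Sx Sy; rewrite -[y]invgK; exact: sgenF Sx (sgenV Sy). Qed.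

Lemma sgen_ind (P : X -> Prop) : P 1 -> (forall x y, P x -> P y -> P (x * y)) ->
  (forall x, P x -> P x^-1) -> (forall s, S s -> P s) -> forall x, gen S x -> P x.
Proof.
move=> P1 PM PV PS; apply: gen_min => //; split=> // x y Px Py.
by apply: PM => //; exact: PV.
Qed.

End Gen.

Lemma gmorph1 (X W : groupType) (h : X -> W) : {morph h : x y / x * y} -> h 1 = 1.
Proof. by move=> hM; apply: (@mulgI _ (h 1)); rewrite -hM !mulg1. Qed.
Lemma gmorphV (X W : groupType) (h : X -> W) :
  {morph h : x y / x * y} -> {morph h : x / x^-1}.
Proof.
by move=> hM x; apply: (@mulgI _ (h x)); rewrite -hM !mulgV (gmorph1 hM).
Qed.
Lemma gmorphJ (X W : groupType) (h : X -> W) :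
  {morph h : x y / x * y} -> {morph h : x y / x ^ y}.
Proof. by move=> hM x y; rewrite /conjg !hM (gmorphV hM). Qed.
Lemma gmorphR (X W : groupType) (h : X -> W) :
  {morph h : x y / x * y} -> {morph h : x y / [~ x, y]}.
Proof. by move=> hM x y; rewrite !commgEl hM (gmorphJ hM) (gmorphV hM). Qed.

Lemma subgroup_ker (X W : groupType) (h : X -> W) :
  {morph h : x y / x * y} -> is_subgroup (fun x => h x = 1).
Proof.
move=> hM; split=> [|x y hx hy]; first exact: gmorph1.
by rewrite hM (gmorphV hM) hx hy mulgV.
Qed.

(** Universal property of the quotient. *)
Lemma quotg_lift (X W : groupType) (N : normal_subgroup X) (h : X -> W) :
  {morph h : x y / x * y} -> (forall x, N x -> h x = 1) ->
  exists2 h' : quotg N -> W,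
    {morph h' : x y / x * y} & forall x, h' (qproj N x) = h x.
Proof.
move=> hM hN; pose h' (u : quotg N) := h (generic_quotient.repr u).
have h'E x : h' (qproj N x) = h x.
  have /qprojP/hN := qproj_repr (qproj N x).
  by rewrite hM (gmorphV hM) -/(h' _) => /mulg1_eq; rewrite invgK.
exists h' => // u v.
by rewrite -(qproj_repr u) -(qproj_repr v) -gmulfM !h'E hM.
Qed.

(** Universal property of the free product: words are evaluated in W. *)
Lemma free_product_lift (A B W : groupType) (f : A -> W) (g : B -> W) :
  {morph f : x y / x * y} -> {morph g : x y / x * y} ->
  exists2 h : free_product A B -> W, {morph h : x y / x * y} &
    (forall a, h (fpl B a) = f a) /\ (forall b, h (fpr A b) = g b).
Proof.
move=> fM gM.
pose ev1 (x : A + B) := match x with inl a => f a | inr b => g b end.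
pose ev w := \prod_(x <- w) ev1 x.
have evP u v : fprel u v -> ev u = ev v.
  elim=> {u v} //.
  - by move=> u v w _ -> _ ->.
  - by move=> u1 u2 v1 v2 _ e1 _ e2; rewrite /ev !big_cat /= -/(ev _) -/(ev _) e1 e2.
  - by rewrite /ev big_seq1 big_nil /= (gmorph1 fM).
  - by rewrite /ev big_seq1 big_nil /= (gmorph1 gM).
  - by move=> a b; rewrite /ev big_seq1 !big_cons big_nil mulg1 /= fM.
  - by move=> a b; rewrite /ev big_seq1 !big_cons big_nil mulg1 /= gM.
pose h (u : free_product A B) := ev (generic_quotient.repr u).
have hE w : h (fpword w) = ev w.
  by apply: evP; apply/fpwordP; rewrite fpword_repr.
exists h => [u v|].
  rewrite -(fpword_repr u) -(fpword_repr v) [_ * _]fpmulE !hE.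
  by rewrite /ev big_cat.
by split=> x; rewrite hE /ev big_seq1.
Qed.

(** * The structure of tau^flat(G) *)

Section TauFlat.
Variable G : finGroupType.
Local Notation E := (tauflat G).

(** The images of x, of x^* and of the commutator [~ x, y^*] in tau^flat(G). *)
Definition tfl (x : G) : E := qproj (Mflat G) (taul x).
Definition tfr (x : G) : E := qproj (Mflat G) (taur x).
Definition tfc (x y : G) : E := [~ tfl x, tfr y].

Lemma tflM : {morph tfl : x y / x * y}.
Proof. by move=> x y; rewrite /tfl /taul /nul !gmulfM. Qed.
Lemma tfrM : {morph tfr : x y / x * y}.
Proof. by move=> x y; rewrite /tfr /taur /nur !gmulfM. Qed.

(** Universal property of tau^flat(G). The relation [~ x, x^*] = 1 is a case of
    the last hypothesis. *)
Lemma tauflat_lift (W : groupType) (L R : G -> W) :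
  {morph L : x y / x * y} -> {morph R : x y / x * y} ->
  (forall x y z, [~ L x, R y] ^ L z = [~ L (x ^ z), R (y ^ z)]) ->
  (forall x y z, [~ L x, R y] ^ R z = [~ L (x ^ z), R (y ^ z)]) ->
  (forall x y, commute x y -> [~ L x, R y] = 1) ->
  exists2 h : E -> W, {morph h : x y / x * y} &
    (forall x, h (tfl x) = L x) /\ (forall y, h (tfr y) = R y).
Proof.
move=> LM RM LJ RJ LR1.
have [h0 h0M [h0l h0r]] := free_product_lift LM RM.
have [|h1 h1M h1E] := @quotg_lift _ _ (nu_kernel G) _ h0M.
  move=> x; apply: (gen_min (subgroup_ker h0M)) => _ [s [w [[x1 [y [z e]]] ->]]].
  rewrite (gmorphJ h0M); suff -> : h0 s = 1 by rewrite conj1g.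
  by case: e => ->; rewrite h0M (gmorphV h0M) (gmorphJ h0M) !(gmorphR h0M) !h0l
    !h0r ?LJ ?RJ mulgV.
have [|h2 h2M h2E] := @quotg_lift _ _ (nabla G) _ h1M.
  move=> x; apply: (gen_min (subgroup_ker h1M)) => _ [y ->].
  by rewrite (gmorphR h1M) /nul /nur !h1E h0l h0r LR1.
have [|h3 h3M h3E] := @quotg_lift _ _ (Mflat G) _ h2M.
  move=> x; apply: (gen_min (subgroup_ker h2M)) => _ [y [z [/eqP/commgP yz ->]]].
  by rewrite (gmorphR h2M) /taul /taur /nul /nur !(h2E, h1E) h0l h0r LR1.
exists h3 => //; split=> x.
- by rewrite /tfl /taul /nul h3E h2E h1E h0l.
- by rewrite /tfr /taur /nur h3E h2E h1E h0r.
Qed.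

Lemma tauflat_ind (P : E -> Prop) :
  P 1 -> (forall a u, P u -> P (tfl a * u)) ->
  (forall b u, P u -> P (tfr b * u)) -> forall u, P u.
Proof.
move=> P1 Pl Pr u; rewrite -(qproj_repr u).
move: (generic_quotient.repr u) => {}u.
rewrite -(qproj_repr u); move: (generic_quotient.repr u) => {}u.
elim/nu_ind: u => [|a u Pu|b u Pu].
- by rewrite !gmulf1.
- by rewrite !gmulfM; exact: Pl.
- by rewrite !gmulfM; exact: Pr.
Qed.

Lemma tfc_conj_l x y z : tfc x y ^ tfl z = tfc (x ^ z) (y ^ z).
Proof.
have := congr1 (qproj (Mflat G)) (tau_conjl x y z).
by rewrite gmulfJ (gmulfR _ (taul x)) (gmulfR _ (taul (x ^ z))).
Qed.
Lemma tfc_conj_r x y z : tfc x y ^ tfr z = tfc (x ^ z) (y ^ z).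
Proof.
have := congr1 (qproj (Mflat G)) (tau_conjr x y z).
by rewrite gmulfJ (gmulfR _ (taul x)) (gmulfR _ (taul (x ^ z))).
Qed.
Lemma tfc_commute x y : commute x y -> tfc x y = 1.
Proof.
move=> /commgP/eqP xy; rewrite /tfc -(gmulfR (qproj (Mflat G))).
apply/esym/qprojP; rewrite invg1 mul1g.
by apply: Defs.subset_gen; exists x, y.
Qed.

(** The subgroup [G, G^*] of tau^flat(G). *)
Definition tfT : E -> Prop := gen (fun t => exists x y, t = tfc x y).

Lemma tfTc x y : tfT (tfc x y).
Proof. by apply: Defs.subset_gen; exists x, y. Qed.

Lemma tfT_conj_l t z : tfT t -> tfT (t ^ tfl z).
Proof.
apply: (@sgen_ind _ _ (fun t => tfT (t ^ tfl z))) => [|x y|x|_ [x [y ->]]].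
- by rewrite conj1g; exact: sgen1.
- by rewrite conjMg; exact: sgenM.
- by rewrite conjVg; exact: sgenV.
- by rewrite tfc_conj_l; exact: tfTc.
Qed.

Lemma tfT_conj_lr t z : tfT t -> t ^ tfl z = t ^ tfr z.
Proof.
apply: (@sgen_ind _ _ (fun t => t ^ tfl z = t ^ tfr z)) => [|x y|x|_ [x [y ->]]].
- by rewrite !conj1g.
- by rewrite !conjMg => -> ->.
- by rewrite !conjVg => ->.
- by rewrite tfc_conj_l tfc_conj_r.
Qed.

Lemma tf_fold_exists : exists2 h : E -> G, {morph h : x y / x * y} &
  (forall x, h (tfl x) = x) /\ (forall y, h (tfr y) = y).
Proof.
apply: tauflat_lift => // [x y z|x y z|x y /commgP/eqP //]; exact: conjRg.
Qed.
Lemma tf_proj_exists (s : bool) : exists2 h : E -> G, {morph h : x y / x * y} &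
  (forall x, h (tfl x) = if s then x else 1) /\
  (forall y, h (tfr y) = if s then 1 else y).
Proof.
by case: s; apply: tauflat_lift => [x y|x y|x y z|x y z|x y _];
  rewrite ?mulg1 ?commg1 ?comm1g ?conj1g.
Qed.

(** The homomorphism with l x |-> x and r y |-> y; on [tfT] it is kappa. *)
Definition tf_fold : E -> G := s2val (cid2 tf_fold_exists).
(** The homomorphisms to G that kill r(G) and l(G) respectively. *)
Definition tf_pr1 : E -> G := s2val (cid2 (tf_proj_exists true)).
Definition tf_pr2 : E -> G := s2val (cid2 (tf_proj_exists false)).

Lemma tf_foldM : {morph tf_fold : x y / x * y}.
Proof. exact: (s2valP (cid2 tf_fold_exists)). Qed.
Lemma tf_fold_l x : tf_fold (tfl x) = x.
Proof. exact: (s2valP' (cid2 tf_fold_exists)).1. Qed.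
Lemma tf_fold_r x : tf_fold (tfr x) = x.
Proof. exact: (s2valP' (cid2 tf_fold_exists)).2. Qed.
Lemma tf_pr1M : {morph tf_pr1 : x y / x * y}.
Proof. exact: (s2valP (cid2 (tf_proj_exists true))). Qed.
Lemma tf_pr1_l x : tf_pr1 (tfl x) = x.
Proof. exact: (s2valP' (cid2 (tf_proj_exists true))).1. Qed.
Lemma tf_pr1_r x : tf_pr1 (tfr x) = 1.
Proof. exact: (s2valP' (cid2 (tf_proj_exists true))).2. Qed.
Lemma tf_pr2M : {morph tf_pr2 : x y / x * y}.
Proof. exact: (s2valP (cid2 (tf_proj_exists false))). Qed.
Lemma tf_pr2_l x : tf_pr2 (tfl x) = 1.
Proof. exact: (s2valP' (cid2 (tf_proj_exists false))).1. Qed.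
Lemma tf_pr2_r x : tf_pr2 (tfr x) = x.
Proof. exact: (s2valP' (cid2 (tf_proj_exists false))).2. Qed.

Lemma tf_fold_c x y : tf_fold (tfc x y) = [~ x, y].
Proof. by rewrite (gmorphR tf_foldM) tf_fold_l tf_fold_r. Qed.

(** The homomorphism whose kernel is shown to be isomorphic to the Bogomolov
    multiplier. *)
Definition tf3 (e : E) : G * G * G := (tf_fold e, tf_pr1 e, tf_pr2 e).
Lemma tf3M : {morph tf3 : x y / x * y}.
Proof. by move=> x y; rewrite /tf3 tf_foldM tf_pr1M tf_pr2M. Qed.
Lemma tf3_l x : tf3 (tfl x) = (x, x, 1).
Proof. by rewrite /tf3 tf_fold_l tf_pr1_l tf_pr2_l. Qed.
Lemma tf3_r x : tf3 (tfr x) = (x, 1, x).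
Proof. by rewrite /tf3 tf_fold_r tf_pr1_r tf_pr2_r. Qed.

Lemma tfT_pr t : tfT t -> tf_pr1 t = 1 /\ tf_pr2 t = 1.
Proof.
move=> Tt; split; move: t Tt; apply: gen_min;
  [exact: subgroup_ker tf_pr1M| |exact: subgroup_ker tf_pr2M|] => _ [x [y ->]].
- by rewrite (gmorphR tf_pr1M) tf_pr1_l tf_pr1_r commg1.
- by rewrite (gmorphR tf_pr2M) tf_pr2_l tf_pr2_r comm1g.
Qed.

(** Every element of tau^flat(G) acts on [tfT] through its image in G. *)
Lemma tfT_conj_fold t e : tfT t -> t ^ e = t ^ tfl (tf_fold e).
Proof.
elim/tauflat_ind: e t => [|a u IH|b u IH] t Tt.
- by rewrite (gmorph1 tf_foldM) (gmorph1 tflM).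
- by rewrite tf_foldM tflM !conjgM tf_fold_l IH //; exact: tfT_conj_l.
- rewrite tf_foldM tflM !conjgM tf_fold_r -tfT_conj_lr // IH //; exact: tfT_conj_l.
Qed.

Lemma tfT_normal t e : tfT t -> tfT (t ^ e).
Proof. by move=> Tt; rewrite tfT_conj_fold //; exact: tfT_conj_l. Qed.

Lemma tfcMr x y z : tfc x (y * z) = tfc x z * tfc x y ^ tfr z.
Proof. by rewrite /tfc tfrM /commg /conjg !invgM !mulgA !mulgK. Qed.
Lemma tfcMl x y z : tfc (x * y) z = tfc x z ^ tfl y * tfc y z.
Proof. by rewrite /tfc tflM /commg /conjg !invgM !mulgA !mulgK. Qed.

Lemma tfl_conj_r a b : tfl a ^ tfr b = tfl a * tfc a b.
Proof. by rewrite /tfc commgEl mulVKg. Qed.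

(** The case of a generator: expand the commutator and conjugate by one factor at
    a time. *)
Lemma tfl_conj_comm x y z : tfl z ^ tfc x y = tfl z ^ tfr [~ x, y].
Proof.
have -> : tfc x y = (tfl x)^-1 * (tfr y)^-1 * tfl x * tfr y.
  by rewrite /tfc /commg /conjg !mulgA.
rewrite !conjgM -!(gmorphV tflM) -!(gmorphV tfrM)
  (_ : tfl z ^ tfl x^-1 = tfl (z ^ x^-1)); last first.
  by rewrite (gmorphJ tflM).
rewrite tfl_conj_r conjMg tfc_conj_l (_ : tfl _ ^ tfl x = tfl z); last first.
  by rewrite -(gmorphJ tflM) conjgKV.
rewrite conjgKV conjMg tfl_conj_r -mulgA -tfcMr -tfl_conj_r; congr (_ ^ tfr _).
by rewrite commgEr.
Qed.

(** The generators l z are conjugated by t in [tfT] as by r (mu t). *)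
Lemma tfl_conj_fold z t : tfT t -> tfl z ^ t = tfl z ^ tfr (tf_fold t).
Proof.
have cJ a b s : tfT s -> tfc a b ^ s = tfc a b ^ tfr (tf_fold s).
  by move=> Ts; rewrite tfT_conj_fold ?tfT_conj_lr //; exact: tfTc.
pose P t := tfT t /\ forall z, tfl z ^ t = tfl z ^ tfr (tf_fold t).
move=> Tt; suff [_ //] : P t.
move: t Tt; apply: sgen_ind => [|t s [Tt et] [Ts es]|t [Tt et]|_ [x [y ->]]].
- split; first exact: sgen1.
  by move=> u; rewrite (gmorph1 tf_foldM) (gmorph1 tfrM).
- split; first exact: sgenM.
  move=> u; rewrite conjgM et tfl_conj_r conjMg es cJ // -conjMg -tfl_conj_r -conjgM.
  by rewrite -tfrM -tf_foldM.
- split; first exact: sgenV.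
  move=> u; apply: (@conjg_inj _ t); rewrite conjgKV (gmorphV tf_foldM).
  by rewrite tfl_conj_r conjMg et cJ // -conjMg -tfl_conj_r -conjgM -tfrM mulVg
    (gmorph1 tfrM) conjg1.
- by split; [exact: tfTc | move=> u; rewrite tf_fold_c tfl_conj_comm].
Qed.

Lemma commg_tfT z t : tfT t -> [~ tfl z, t] = tfc z (tf_fold t).
Proof. by move=> Tt; rewrite /tfc !commgEl tfl_conj_fold. Qed.

(** Antisymmetry: expand [tfc] at the pair (x y, x y), where it is trivial. *)
Lemma tfcV x y : (tfc x y)^-1 = tfc y x.
Proof.
have e : tfc (x * y) (x * y) = 1 by exact: tfc_commute.
have c1 a : tfc a a = 1 by exact: tfc_commute.
rewrite tfcMl !tfcMr !c1 conj1g mul1g mulg1 -tfT_conj_lr in e; last exact: tfTc.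
rewrite -conjMg in e; apply: mulg1_eq.
by apply: (@conjg_inj _ (tfl y)); rewrite e conj1g.
Qed.

Lemma tfT_commg s t : tfT s -> tfT t -> [~ s, t] = tfc (tf_fold s) (tf_fold t).
Proof.
move=> Ts Tt; rewrite commgEl tfT_conj_fold // -commgEl -[LHS]invgK invgR.
by rewrite commg_tfT // tfcV.
Qed.

(** Every e is l a * r b times an element of [tfT]. *)
Lemma tf_normal_form e : tfT ((tfl (tf_pr1 e) * tfr (tf_pr2 e))^-1 * e).
Proof.
elim/tauflat_ind: e => [|a u IH|b u IH].
- rewrite (gmorph1 tf_pr1M) (gmorph1 tf_pr2M) (gmorph1 tflM) (gmorph1 tfrM).
  by rewrite !mulg1 invg1; exact: sgen1.
- by rewrite tf_pr1M tf_pr2M tf_pr1_l tf_pr2_l mul1g tflM -mulgA invgM mulgA mulgVK.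
- rewrite tf_pr1M tf_pr2M tf_pr1_r tf_pr2_r mul1g tfrM.
  move: (tf_pr1 u) (tf_pr2 u) IH => x y IH.
  have -> : (tfl x * (tfr b * tfr y))^-1 * (tfr b * u) =
    [~ tfr b, tfl x] ^ tfr y * ((tfl x * tfr y)^-1 * u).
    by rewrite /commg /conjg !invgM !mulgA !mulgK.
  apply: sgenM => //; apply: tfT_normal; rewrite -invgR; apply: sgenV; exact: tfTc.
Qed.

Lemma tf3_kerT e : tf3 e = 1 -> tfT e.
Proof.
move=> [_ e1 e2]; have := tf_normal_form e.
by rewrite e1 e2 (gmorph1 tflM) (gmorph1 tfrM) mulg1 invg1 mul1g.
Qed.

(** An element t of [tfT] with mu t = 1 acts trivially on [tfT] and on l(G), and
    r z moves t to the same element as l z. *)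
Lemma tf3_ker_central e u : tf3 e = 1 -> commute e u.
Proof.
move=> e1; have Te := tf3_kerT e1; case: e1 => e1 _ _.
apply/commgP; rewrite -conjg_fix tfT_conj_fold // conjg_fix -[X in X == _]invgK invgR.
by rewrite commg_tfT // e1 /tfc (gmorph1 tfrM) commg1 invg1.
Qed.

End TauFlat.

(** * Divisibility and injectivity of Q/Z *)

Section QZTheory.
Local Open Scope ring_scope.

(** The projection of the rational numbers onto Q/Z. *)
Definition ratQZ (r : rat) : QZ := \pi_(Quotient.quot int_rat)%qT r.

Lemma ratQZ_zmod : zmod_morphism ratQZ.
Proof. exact: raddfB. Qed.
HB.instance Definition _ := GRing.isZmodMorphism.Build rat QZ ratQZ ratQZ_zmod.

Lemma ratQZ_surj q : exists r, q = ratQZ r.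
Proof. by exists (generic_quotient.repr q); rewrite /ratQZ generic_quotient.reprK. Qed.

Lemma ratQZ_eq0 r : (ratQZ r == 0) = (r \is a Num.int).
Proof.
have := @Quotient.idealrBE _ int_rat r 0; rewrite subr0 => e.
transitivity (r \in int_rat) => //.
rewrite e; congr (_ == _); exact/esym/(raddf0 ratQZ).
Qed.

Lemma QZ_divisible k (q : QZ) : (0 < k)%N -> exists a, a *+ k = q.
Proof.
move=> k0; have [r ->] := ratQZ_surj q; exists (ratQZ (r / k%:R)).
rewrite -raddfMn -[_ *+ k]mulr_natr divfK // pnatr_eq0; exact: lt0n_neq0.
Qed.

Lemma QZ_divisible_neq0 k (q : QZ) : (1 < k)%N -> exists2 a, a *+ k = q & a != 0.
Proof.
move=> k1; have k0 := ltnW k1; have [a ak] := QZ_divisible q k0.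
have [a0|a0] := eqVneq a 0; last by exists a.
have kp : 0 < k%:R :> rat by rewrite ltr0n.
exists (ratQZ k%:R^-1).
  rewrite -raddfMn -[_ *+ k]mulr_natr mulVf ?gt_eqF // -ak a0 mul0rn.
  by apply/eqP; rewrite ratQZ_eq0 rpred1.
rewrite ratQZ_eq0; apply/negP => /intrP [z ez].
have z0 : 0 < z by rewrite -(ltr0z rat) -ez invr_gt0.
have : z < 1 by rewrite -(ltrz1 rat) -ez invf_lt1 // ltr1n.
by rewrite ltNge -gtz0_ge1 z0.
Qed.

Lemma QZ_torsion k (q : QZ) : (0 < k)%N -> q *+ k = 0 ->
  exists2 i, (i < k)%N & q = ratQZ (i%:R / k%:R).
Proof.
move=> k0; have [r ->] := ratQZ_surj q; rewrite -raddfMn => /eqP.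
rewrite ratQZ_eq0 => /intrP [z ez].
have kn0 : k%:R != 0 :> rat by rewrite pnatr_eq0 -lt0n.
have er : r = z%:~R / k%:R by rewrite -ez -[r *+ k]mulr_natr mulfK.
have kz0 : k%:Z != 0 by rewrite -lt0n in k0 *.
have lt : ((z %% k%:Z)%Z < k%:Z) by rewrite ltz_mod.
have ge : 0 <= (z %% k%:Z)%Z by rewrite modz_ge0.
exists `|(z %% k%:Z)%Z|%N; first by rewrite -ltz_nat gez0_abs.
apply/eqP; rewrite -subr_eq0 -raddfB ratQZ_eq0; apply/intrP; exists (z %/ k%:Z)%Z.
rewrite er -mulrBl {1}(divz_eq z k%:Z) natr_absz ger0_norm // intrD addrK intrM.
by rewrite mulfK.
Qed.

End QZTheory.

(** Zorn's lemma for inclusion of predicates; the empty chain is allowed, so P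
    must hold of the empty predicate. *)
Lemma Zorn_pred T (P : (T -> Prop) -> Prop) :
  (forall F : (T -> Prop) -> Prop, (forall A, F A -> P A) ->
    (forall A B, F A -> F B -> (forall x, A x -> B x) \/ (forall x, B x -> A x)) ->
    P (fun x => exists2 A, F A & A x)) ->
  exists A, P A /\ forall B, (forall x, A x -> B x) -> P B -> forall x, B x -> A x.
Proof.
move=> Pch; have [A [PA Amax]] := @classical_sets.Zorn_bigcup T P Pch.
exists A; split=> // B AB PB x Bx; apply: contrapT => nAx.
by apply: (Amax B) => //; split=> // BA; apply: nAx; apply: BA.
Qed.

Section Injective.
Variables (X : groupType) (D : X -> Prop).
Hypothesis Dsub : is_subgroup D.

Let D1 : D 1. Proof. by case: Dsub. Qed.
Let DF x y : D x -> D y -> D (x * y^-1). Proof. by case: Dsub => _; apply. Qed.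
Let DV x : D x -> D x^-1.
Proof. by move=> Dx; rewrite -[x^-1]mul1g; exact: DF. Qed.
Let DM x y : D x -> D y -> D (x * y).
Proof. by move=> Dx Dy; rewrite -[y]invgK; apply: DF => //; exact: DV. Qed.
Let DX x n : D x -> D (x ^+ n).
Proof. by move=> Dx; elim: n => [|n IH]; rewrite ?expgS //; exact: DM. Qed.

(** The graph of a homomorphism to Q/Z that is defined on a subgroup between
    [D, D] and D and vanishes on [D, D]. *)
Record partial_char (A : X * QZ -> Prop) : Prop := PartialChar {
  pch_1 : A (1, 0%R);
  pch_F : forall x y p q, A (x, p) -> A (y, q) -> A (x * y^-1, (p - q)%R);
  pch_fun : forall q, A (1, q) -> q = 0%R;
  pch_dom : forall x q, A (x, q) -> D x;
  pch_R : forall x y, D x -> D y -> A ([~ x, y], 0%R) }.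

Section PC.
Variable A : X * QZ -> Prop.
Hypothesis pA : partial_char A.

Lemma pch_V x p : A (x, p) -> A (x^-1, (- p)%R).
Proof. by move=> Ax; have := pch_F pA (pch_1 pA) Ax; rewrite mul1g sub0r. Qed.
Lemma pch_M x y p q : A (x, p) -> A (y, q) -> A (x * y, (p + q)%R).
Proof. by move=> Ax /pch_V Ay; have := pch_F pA Ax Ay; rewrite invgK opprK. Qed.
Lemma pch_X x p n : A (x, p) -> A (x ^+ n, (p *+ n)%R).
Proof.
move=> Ax; elim: n => [|n IH]; first exact: pch_1.
by rewrite expgS mulrS; exact: pch_M.
Qed.
Lemma pch_uniq x p q : A (x, p) -> A (x, q) -> p = q.
Proof.
move=> Ap Aq; have := pch_F pA Ap Aq; rewrite mulgV => /(pch_fun pA).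
by move/eqP; rewrite subr_eq0 => /eqP.
Qed.
Lemma pch_swap u v w q : D v -> D w -> A (u * v * w, q) -> A (u * w * v, q).
Proof.
move=> Dv Dw Au; have := pch_M Au (pch_R pA Dw Dv).
have -> : u * v * w * [~ w, v] = u * w * v.
  by rewrite -[u * w * v]mulgA (commgC w) !mulgA.
by rewrite addr0.
Qed.

(** A partial character extends to x in D, with a nonzero value at x if x is
    not yet in the domain. *)
Lemma pch_step x : D x -> exists B, [/\ partial_char B,
  (forall z, A z -> B z) & exists2 q, B (x, q) & (forall q, ~ A (x, q)) -> q != 0%R].
Proof.
move=> Dx.
(* a is the value at x: it is compatible with all powers of x in the domain. *)
have [a [aP a0]] : exists a : QZ, (forall n q, A (x ^+ n, q) -> q = (a *+ n)%R) /\
    ((forall q, ~ A (x, q)) -> a != 0%R).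
  have [[k k0]|nk] := pselect (exists2 k, 0 < k & exists q, A (x ^+ k, q)).
    move=> ex0; have exk : exists k, (0 < k) && `[< exists q, A (x ^+ k, q) >].
      by exists k; rewrite k0; apply/asboolP.
    case: (ex_minnP exk) => {exk k k0 ex0} k /andP[k0 /asboolP [q Aq]] kmin.
    have [a ak a0] : exists2 a, (a *+ k = q)%R & (forall q, ~ A (x, q)) -> a != 0%R.
      have [k1|k1] := ltnP 1 k.
        by have [a ? ?] := QZ_divisible_neq0 q k1; exists a.
      have ek : k = 1%N by apply/eqP; rewrite eqn_leq k1.
      by exists q => [|/(_ q) []]; [rewrite ek | rewrite ek in Aq].
    exists a; split=> // n p Ap.
    have dn : x ^+ n = x ^+ (n %% k) * (x ^+ k) ^+ (n %/ k).
      by rewrite -expgnA -expgnDr addnC mulnC -divn_eq.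
    have Ak := pch_X (n %/ k) Aq.
    have Ar := pch_F pA Ap Ak; rewrite {1}dn mulgK in Ar.
    have r0 : n %% k = 0.
      apply/eqP; rewrite -leqn0 leqNgt; apply/negP => r0.
      have := kmin (n %% k); rewrite r0 /= leqNgt ltn_pmod //.
      by move=> h; suff: false by []; apply: h; apply/asboolP; eexists; exact: Ar.
    rewrite dn r0 mul1g in Ap.
    by rewrite (pch_uniq Ap Ak) -ak -mulrnA {2}(divn_eq n k) r0 addn0 mulnC.
  have [a _ a0] := QZ_divisible_neq0 0%R (isT : 1 < 2); exists a; split=> // -[|n] q Aq.
    exact: (pch_fun pA).
  by case: nk; exists n.+1 => //; exists q.
(* z is in the new domain if z x^n x^-m is in the old one. *)
pose B z := D z.1 /\ exists n m,
  A (z.1 * (x ^+ n * x ^- m), (z.2 + (a *+ n - a *+ m))%R).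
have cx n m : commute (x ^- m) (x ^+ n) by exact/commute_sym/commuteV/commuteX2.
exists B; split; last first.
- exists a => //; split=> //; exists 0, 1%N; rewrite /= mul1g mulgV mulr0n sub0r subrr.
  exact: pch_1.
- move=> [y p] Ay; split; first exact: (pch_dom pA) Ay.
  by exists 0, 0; rewrite /= invg1 !mulg1 mulr0n subrr addr0.
split.
- by split=> //; exists 0, 0; rewrite /= invg1 !mulg1 mulr0n subrr addr0; exact: pch_1.
- move=> y y' p p' [/= Dy [n [m Ay]]] [/= Dy' [n' [m' Ay']]].
  split; first exact: DF.
  exists (n + m'), (m + n') => /=.
  have := pch_F pA Ay Ay'.
  have -> u v : y * u * (y' * v)^-1 = y * (u * v^-1) * y'^-1.
    by rewrite invgM !mulgA.
  move=> /pch_swap h.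
  have {h} := h (DF (DM (DX _ Dx) (DV (DX _ Dx))) (DM (DX _ Dx) (DV (DX _ Dx)))) (DV Dy').
  congr (A (_, _)).
    rewrite (addnC m) !expgnDr !invgM !invgK -!mulgA; do 3!congr (_ * _).
    by rewrite !mulgA; congr (_ * _); exact: cx.
  rewrite !mulrnDr !opprD !opprK.
  rewrite [LHS]addrACA; congr (_ + _)%R.
  by rewrite [(- (a *+ n') + _)%R]addrC [LHS]addrACA.
- move=> p [/= _ [n [m]]]; rewrite mul1g => Ap.
  have [mn|/ltnW nm] := leqP m n.
    move: Ap; rewrite -expgnFr // => /aP; rewrite mulrnBr // => /eqP.
    by rewrite -subr_eq0 addrK => /eqP.
  have := pch_V Ap; rewrite invgM invgK -expgnFr // => /aP.
  rewrite mulrnBr // opprD opprB => /eqP.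
  by rewrite -subr_eq0 addrK oppr_eq0 => /eqP.
- by move=> y q [].
- move=> y z Dy Dz; split=> /=.
    by rewrite commgEl; apply: DM; [exact: DV|apply: DM; [exact: DV|exact: DM]].
  exists 0, 0; rewrite /= invg1 !mulg1 mulr0n subrr addr0; exact: (pch_R pA).
Qed.

End PC.

(** Injectivity of Q/Z, for a group D that need not be abelian: partial
    characters extend to D. The values of chi outside D are irrelevant. *)
Theorem QZ_injective A0 : partial_char A0 -> exists chi : X -> QZ,
  (forall x y, D x -> D y -> chi (x * y) = (chi x + chi y)%R) /\
  (forall x q, A0 (x, q) -> chi x = q).
Proof.
move=> pA0.
(* The first alternative makes P true of the union of the empty chain. *)
pose P A := (forall z, ~ A z) \/ partial_char A /\ forall z : X * QZ, A0 z -> A z.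
have [|A [PA Amax]] := @Zorn_pred (X * QZ) P.
  move=> F FP Ftot.
  have [[A FA [z Az]]|none] := pselect (exists2 A, F A & exists z, A z); last first.
    by left=> z [A FA Az]; apply: none; exists A => //; exists z.
  have good B z' : F B -> B z' -> partial_char B /\ forall z : X * QZ, A0 z -> B z.
    by move=> /FP [/(_ z')|].
  have [pA A0A] := good _ _ FA Az.
  right; split=> [|z' /A0A ?]; last by exists A.
  split.
  - by exists A => //; exact: pch_1.
  - move=> x y p q [B FB Bx] [C FC Cy].
    have [BC|CB] := Ftot _ _ FB FC.
      exists C => //; apply: (pch_F (good _ _ FC Cy).1) => //; exact: BC.
    exists B => //; apply: (pch_F (good _ _ FB Bx).1) => //; exact: CB.
  - by move=> q [B FB Bq]; exact: (pch_fun (good _ _ FB Bq).1).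
  - by move=> x q [B FB Bq]; exact: (pch_dom (good _ _ FB Bq).1 Bq).
  - by move=> x y Dx Dy; exists A => //; exact: pch_R.
have [pA A0A] : partial_char A /\ forall z, A0 z -> A z.
  case: PA => // Anone; exfalso.
  apply: (Anone (1, 0%R)); apply: (Amax A0); last exact: pch_1.
    by move=> z /Anone.
  by right.
have tot x : exists q, D x -> A (x, q).
  have [Dx|nDx] := pselect (D x); last by exists 0%R.
  have [B [pB AB [q Bq _]]] := pch_step pA Dx.
  by exists q => _; apply: (Amax B) => //; right; split=> // z /A0A /AB.
have [chi chiP] := choice tot; exists chi; split=> [x y Dx Dy|x q xq].
  exact: (pch_uniq pA (chiP _ (DM Dx Dy)) (pch_M pA (chiP _ Dx) (chiP _ Dy))).
have Ax := A0A _ xq.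
exact: (pch_uniq pA (chiP _ (pch_dom pA Ax)) Ax).
Qed.

(** Homomorphisms to Q/Z separate the elements of an abelian group D. *)
Corollary QZ_separates b : (forall x y, D x -> D y -> commute x y) ->
  D b -> b != 1 -> exists2 chi : X -> QZ,
    (forall x y, D x -> D y -> chi (x * y) = (chi x + chi y)%R) & chi b != 0%R.
Proof.
move=> cD Db b1; pose A (z : X * QZ) := z = (1, 0%R).
have pA : partial_char A.
  split=> [|_ _ _ _ [-> ->] [-> ->]|q [->]|x q [-> _]|x y Dx Dy] //.
    by rewrite /A mulgV subrr.
  by congr (_, _); apply/eqP/commgP; exact: cD.
have [B [pB _ [q Bq q0]]] := pch_step pA Db.
have [chi [chiM chiB]] := QZ_injective pB; exists chi => //.
by rewrite (chiB _ _ Bq); apply: q0 => p [/eqP]; rewrite (negPf b1).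
Qed.

End Injective.

(** * Central extensions by cocycles with values in Q/Z *)

(** A 2-cocycle on H with trivial coefficients Q/Z that vanishes at (1, 1). *)
Record ncocycle (H : groupType) := NCocycle {
  ncoc :> H -> H -> QZ;
  ncocP : forall x y z, (ncoc x y + ncoc (x * y)%g z = ncoc y z + ncoc x (y * z)%g)%R;
  ncoc11 : ncoc 1 1 = 0%R }.

(** The central extension of H by Q/Z with cocycle f; its elements are the pairs
    (x, q). *)
Definition cext (H : groupType) (f : ncocycle H) : Type := (H * QZ)%type.

Section CExt.
Variables (H : groupType) (f : ncocycle H).

Lemma ncoc1l x : f 1 x = 0%R.
Proof.
have /eqP := ncocP f 1 1 x; rewrite !mul1g ncoc11 add0r -subr_eq0.
by rewrite opprD addrA subrr add0r oppr_eq0 => /eqP.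
Qed.
Lemma ncoc1r x : f x 1 = 0%R.
Proof.
have /eqP := ncocP f x 1 1.
by rewrite !mulg1 ncoc11 add0r -subr_eq0 addrK => /eqP.
Qed.
Lemma ncocV x : f x x^-1 = f x^-1 x.
Proof. by have := ncocP f x x^-1 x; rewrite mulgV mulVg ncoc1l ncoc1r !addr0. Qed.

Local Notation cext := (cext f).
HB.instance Definition _ := Choice.copy cext (H * QZ)%type.

Definition cmul (u v : cext) : cext := (u.1 * v.1, (u.2 + v.2 + f u.1 v.1)%R).
Definition cone : cext := (1, 0%R).
Definition cinv (u : cext) : cext := (u.1^-1, (- u.2 - f (u.1^-1)%g u.1)%R).

Lemma cmulA : associative cmul.
Proof.
move=> [x p] [y q] [z r]; congr (_, _) => /=; first exact: mulgA.
rewrite -!addrA; congr (_ + _)%R; congr (_ + _)%R.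
by rewrite ![(_ + (r + _))%R]addrCA ncocP.
Qed.
Lemma cmul1 : left_id cone cmul.
Proof. by move=> [x p]; rewrite /cmul /= mul1g ncoc1l add0r addr0. Qed.
Lemma cmulg1 : right_id cone cmul.
Proof. by move=> [x p]; rewrite /cmul /= mulg1 ncoc1r !addr0. Qed.
Lemma cmulV : left_inverse cone cinv cmul.
Proof.
move=> [x p]; rewrite /cmul /cone /= mulVg; congr (_, _).
by rewrite [(- p - _)%R]addrC subrK addrC subrr.
Qed.
Lemma cmulgV : right_inverse cone cinv cmul.
Proof.
move=> [x p]; rewrite /cmul /cone /= mulgV ncocV; congr (_, _).
by rewrite addrA subrr sub0r addrC subrr.
Qed.
HB.instance Definition _ := isGroup.Build cext cmulA cmul1 cmulg1 cmulV cmulgV.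

(** The central subgroup Q/Z. *)
Definition cz (q : QZ) : cext := (1, q).

Lemma cextM (u v : cext) : u * v = (u.1 * v.1, (u.2 + v.2 + f u.1 v.1)%R).
Proof. by []. Qed.
Lemma cext_fstM : {morph (fun u : cext => u.1) : u v / u * v}.
Proof. by []. Qed.
Lemma czM : {morph cz : p q / (p + q)%R >-> p * q}.
Proof. by move=> p q; rewrite cextM /= mulg1 ncoc11 addr0. Qed.
Lemma cz_central q u : commute (cz q) u.
Proof.
by case: u => x p; rewrite /commute !cextM /= mul1g mulg1 ncoc1l ncoc1r [(q + p)%R]addrC.
Qed.
Lemma mul_cz u q : u * cz q = (u.1, (u.2 + q)%R).
Proof. by rewrite cextM /= mulg1 ncoc1r addr0. Qed.
Lemma cext_split (u : cext) : u = ((u.1, 0%R) : cext) * cz u.2.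
Proof. by rewrite mul_cz add0r; case: u. Qed.

(** Commutators depend only on the images in H. *)
Lemma cext_commg (u v u' v' : cext) :
  u.1 = u'.1 -> v.1 = v'.1 -> [~ u, v] = [~ u', v'].
Proof.
have cc (a b : cext) q : [~ a * cz q, b] = [~ a, b].
  rewrite !commgEl conjMg invgM (_ : cz q ^ b = cz q); last first.
    apply/conjg_fixP/commgP; exact: cz_central.
  by rewrite mulgA -(cz_central q) !mulgA mulgV mul1g.
have cc' (a b : cext) q : [~ a, b * cz q] = [~ a, b].
  by rewrite -invgR cc invgR.
move=> eu ev; rewrite [u]cext_split [v]cext_split [u']cext_split [v']cext_split.
by rewrite !cc !cc' eu ev.
Qed.

End CExt.

Section Split.
Variables (G : finGroupType) (f : ncocycle G) (A : {group G}).

(** A symmetric cocycle on an abelian group is a coboundary, because its extension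
    is abelian and Q/Z is injective. *)
Lemma symmetric_cocycle_split : abelian A ->
  (forall x y, x \in A -> y \in A -> f x y = f y x) ->
  exists c : G -> QZ, forall x y, x \in A -> y \in A ->
    f x y = (c y - c (x * y)%g + c x)%R.
Proof.
move=> cA fA; pose D (w : cext f) := w.1 \in A.
have Dsub : is_subgroup D.
  by split=> [|u v Du Dv]; [exact: group1 | rewrite /D /= groupM // groupV].
pose A0 (w : cext f * QZ) := w.1 = cz f w.2.
have [|chi [chiM chiz]] := @QZ_injective _ D Dsub A0.
  split=> //.
  - move=> x y p q; rewrite /A0 /= => -> ->.
    by apply: (@mulIg _ (cz f q)); rewrite mulgVK -czM subrK.
  - by move=> q [].
  - by move=> x q; rewrite /A0 /= /D => ->; exact: group1.
  - move=> x y Dx Dy; rewrite /A0 /=; apply/eqP/commgP.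
    rewrite /commute !cextM (fA _ _ Dx Dy) [(x.2 + _)%R]addrC; congr (_, _).
    exact: (centsP cA).
exists (fun x => chi (x, 0%R)) => x y Ax Ay.
have := chiM ((x, 0%R) : cext f) ((y, 0%R) : cext f) Ax Ay.
have -> : ((x, 0%R) : cext f) * ((y, 0%R) : cext f) =
          ((x * y, 0%R) : cext f) * cz f (f x y).
  by rewrite mul_cz cextM /= !add0r.
rewrite chiM //; last 2 first; try by rewrite /D /= ?group1 ?groupM.
rewrite (chiz (cz f (f x y)) (f x y) erefl) => e.
apply/eqP; rewrite addrAC [(_ + chi (x, _))%R]addrC -e.
by rewrite [(chi _ + _)%R]addrC addrK.
Qed.

End Split.

Section TFChar.
Variable G : finGroupType.
Local Notation E := (tauflat G).

(** The combination of the three coordinates of G^3. *)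
Definition alt3 (a b c : QZ) : QZ := (a - b - c)%R.

Lemma alt3D a b c a' b' c' :
  alt3 (a + a') (b + b') (c + c') = (alt3 a b c + alt3 a' b' c')%R.
Proof. by rewrite /alt3 [RHS]addrACA [(a - b + _)%R]addrACA !opprD. Qed.
Lemma alt3N a b c : alt3 (- a) (- b) (- c) = (- alt3 a b c)%R.
Proof. by rewrite /alt3 !opprD. Qed.

(** The cocycle f(1) - f(2) - f(3) on G^3. *)
Definition coc3 (f : G -> G -> QZ) (u v : G * G * G) : QZ :=
  alt3 (f u.1.1 v.1.1) (f u.1.2 v.1.2) (f u.2 v.2).

(** phi is the Q/Z-coordinate of the map e |-> (tf3 e, phi e) from tau^flat(G) to
    the extension of G^3 with cocycle [coc3 f], where l x and r y have coordinate
    0. *)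
Definition tfchar (f : G -> G -> QZ) (phi : E -> QZ) : Prop :=
  [/\ forall a, phi (tfl a) = 0%R, forall b, phi (tfr b) = 0%R &
      forall u v, phi (u * v) = (phi u + phi v + coc3 f (tf3 u) (tf3 v))%R].

Lemma tfchar1 f phi : tfchar f phi -> phi 1 = 0%R.
Proof. by case=> h _ _; rewrite -(h 1) (gmorph1 (@tflM G)). Qed.

Lemma tfchar_uniq f phi psi : tfchar f phi -> tfchar f psi -> phi =1 psi.
Proof.
move=> fphi fpsi; have p1 := tfchar1 fphi; have q1 := tfchar1 fpsi.
case: fphi fpsi => pl pr pM [ql qr qM].
by elim/tauflat_ind=> [|a u IH|b u IH]; rewrite ?p1 ?q1 // pM qM ?pl ?ql ?pr ?qr IH.
Qed.

Lemma tfchar_add f g phi psi : tfchar f phi -> tfchar g psi ->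
  tfchar (fun x y => f x y + g x y)%R (fun e => phi e + psi e)%R.
Proof.
case=> pl pr pM [ql qr qM]; split=> [a|b|u v].
- by rewrite pl ql addr0.
- by rewrite pr qr addr0.
- by rewrite pM qM /coc3 alt3D addrACA; congr (_ + _)%R; exact: addrACA.
Qed.

Lemma tfchar_coboundary (c : G -> QZ) : c 1 = 0%R ->
  tfchar (fun x y => c y - c (x * y)%g + c x)%R
    (fun e => - alt3 (c (tf_fold e)) (c (tf_pr1 e)) (c (tf_pr2 e)))%R.
Proof.
move=> c1; split=> [a|b|u v].
- by rewrite tf_fold_l tf_pr1_l tf_pr2_l c1 /alt3 !subr0 subrr oppr0.
- by rewrite tf_fold_r tf_pr1_r tf_pr2_r c1 /alt3 subr0 subrr oppr0.
- have e (x y z : QZ) : (- z = - x - y + (y - z + x))%R.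
    by rewrite -!addrA addKr [(- z + x)%R]addrC addKr.
  rewrite /coc3 /= tf_foldM tf_pr1M tf_pr2M -!alt3N -!alt3D.
  by congr alt3; exact: e.
Qed.

Lemma coc3P (f : ncocycle G) u v w : (coc3 f u v + coc3 f (u * v)%g w =
  coc3 f v w + coc3 f u (v * w)%g)%R.
Proof. by rewrite /coc3 -!alt3D; congr alt3; exact: ncocP. Qed.
Lemma coc311 (f : ncocycle G) : coc3 f 1 1 = 0%R.
Proof. by rewrite /coc3 /alt3 !ncoc11 !subr0. Qed.
Definition ncoc3 (f : ncocycle G) : ncocycle (G * G * G)%type :=
  NCocycle (coc3P f) (coc311 f).

Section Fixed.
Variable f : ncocycle G.
Local Notation W := (cext (ncoc3 f)).

(** Elements above (x, 1, 1), (x, x, 1) and (x, 1, x); [inL] and [inR] are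
    homomorphisms, as the contributions of f to [coc3 f] cancel. *)
Definition in1 (x : G) : W := ((x, 1, 1), 0%R).
Definition inL (x : G) : W := ((x, x, 1), 0%R).
Definition inR (x : G) : W := ((x, 1, x), 0%R).

Hypothesis fsym : forall x y, commute x y -> f x y = f y x.

Lemma cext3_commute (u v : W) : commute u.1.1.1 v.1.1.1 ->
  commute u.1.1.2 v.1.1.2 -> commute u.1.2 v.1.2 -> commute u v.
Proof.
move=> c1 c2 c3; rewrite /commute !cextM [(u.2 + _)%R]addrC.
congr (_, (_ + _)%R); first by congr (_, _, _).
by rewrite /= /coc3; congr alt3; exact: fsym.
Qed.

Lemma commg_inLR x y : [~ inL x, inR y] = [~ in1 x, in1 y].
Proof.
pose i2 (x : G) : W := ((1, x, 1), 0%R); pose i3 (x : G) : W := ((1, 1, x), 0%R).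
have LE : inL x = in1 x * i2 x.
rewrite cextM /= /coc3 /= !ncoc1l !ncoc1r /alt3 !subr0 !addr0 /inL.
by congr ((_, _, _), _); rewrite ?mulg1 ?mul1g.
have RE : inR y = in1 y * i3 y.
rewrite cextM /= /coc3 /= !ncoc1l !ncoc1r /alt3 !subr0 !addr0 /inR.
by congr ((_, _, _), _); rewrite ?mulg1 ?mul1g.
have c23 : commute (i2 x) (in1 y * i3 y).
  by apply: cext3_commute; rewrite /= ?mul1g ?mulg1;
    do ?[exact: commute1|exact/commute_sym/commute1].
rewrite LE RE commgEl conjMg [i2 x ^ _](_ : _ = i2 x); last first.
  by apply/conjg_fixP/commgP.
rewrite invgM -mulgA (mulgA (in1 x)^-1) -commgEl.
have -> : [~ in1 x, in1 y * i3 y] = [~ in1 x, in1 y].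
  rewrite !commgEl conjgM; congr (_ * _); apply/conjg_fixP/commgP.
  have e : (in1 x ^ in1 y).1 = (x ^ y, 1 ^ 1, 1 ^ 1).
    exact: (gmorphJ (@cext_fstM _ (ncoc3 f))).
  by apply: cext3_commute; rewrite e /= ?conj1g;
    do ?[exact: commute1|exact/commute_sym/commute1].
rewrite -conjgE; apply/conjg_fixP/commgP.
have e : [~ in1 x, in1 y].1 = ([~ x, y], [~ 1, 1], [~ 1, 1]).
  exact: (gmorphR (@cext_fstM _ (ncoc3 f))).
by apply: cext3_commute; rewrite e /= ?commg1;
    do ?[exact: commute1|exact/commute_sym/commute1].
Qed.

(** The map of [tfchar] exists if f is symmetric on commuting pairs. *)
Lemma tfchar_exists : exists phi, tfchar f phi.
Proof.
have LRJ x y z (w : W) : w.1.1.1 = z ->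
    [~ inL x, inR y] ^ w = [~ inL (x ^ z), inR (y ^ z)].
  move=> wz; rewrite !commg_inLR conjRg; apply: cext_commg;
    rewrite (gmorphJ (@cext_fstM _ (ncoc3 f))) /= -wz; case: w.1 => [[a b] c] /=;
    by congr (_, _, _); exact: conj1g.
have [x y|x y|x y z|x y z|x y xy|h hM [hl hr]] := @tauflat_lift G W inL inR.
- rewrite cextM /= /coc3 /= ncoc11 /alt3 subrr subr0 !addr0 /inL.
  by congr ((_, _, _), _); rewrite mulg1.
- rewrite cextM /= /coc3 /= ncoc11 /alt3 subr0 subrr !addr0 /inR.
  by congr ((_, _, _), _); rewrite mulg1.
- exact: LRJ.
- exact: LRJ.
- rewrite commg_inLR; apply/eqP/commgP; apply: cext3_commute => //=.
have h1 e : (h e).1 = tf3 e.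
  elim/tauflat_ind: e => [|a u IH|b u IH].
  - by rewrite (gmorph1 hM) (gmorph1 (@tf3M G)).
  - by rewrite hM tf3M (cext_fstM _ _) hl IH tf3_l.
  - by rewrite hM tf3M (cext_fstM _ _) hr IH tf3_r.
exists (fun e => (h e).2); split=> [a|b|u v].
- by rewrite hl.
- by rewrite hr.
- by rewrite hM cextM /= !h1.
Qed.

Variable phi : E -> QZ.
Hypothesis fphi : tfchar f phi.

Definition tf_hom (e : E) : W := (tf3 e, phi e).
Lemma tf_homM : {morph tf_hom : x y / x * y}.
Proof.
by move=> x y; rewrite cextM /tf_hom tf3M; case: fphi => _ _ ->.
Qed.

Lemma tf_hom_c x y : tf_hom (tfc x y) = [~ in1 x, in1 y].
Proof.
rewrite (gmorphR tf_homM) -commg_inLR; case: fphi => pl pr _.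
by congr [~ _, _]; rewrite /tf_hom ?tf3_l ?tf3_r ?pl ?pr.
Qed.

(** If phi vanishes on the kernel of [tf3], then f is a coboundary: the partial
    character tf_hom t * q |-> q (t in [tfT]) of the extension of G by f is well
    defined, and an extension of it splits the cocycle. *)
Lemma tfchar_ker_split : (forall e, tf3 e = 1 -> phi e = 0%R) ->
  exists c : G -> QZ, forall x y, f x y = (c y - c (x * y)%g + c x)%R.
Proof.
move=> phi0; pose D (w : W) := w.1.1.2 = 1 /\ w.1.2 = 1.
have Dsub : is_subgroup D.
  split=> [|u v [u2 u3] [v2 v3]]; first by [].
  by split; rewrite /= ?u2 ?u3 ?v2 ?v3 mulgV.
(* D is the copy of the extension of G by f in the first coordinate. *)
pose A0 (w : W * QZ) := exists2 t, tfT t & w.1 = tf_hom t * cz (ncoc3 f) w.2.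
have hom1 : tf_hom 1 = 1 by exact: gmorph1 tf_homM.
have Tin1 x y : D x -> D y -> [~ x, y] = tf_hom (tfc x.1.1.1 y.1.1.1).
  move: x y => [[[x1 x2] x3] p] [[[y1 y2] y3] q] [/= -> ->] [/= -> ->].
  by rewrite tf_hom_c; exact: cext_commg.
have [|chi [chiM chiz]] := @QZ_injective _ D Dsub A0.
  split.
  - by exists 1; [exact: sgen1 | rewrite hom1 mul1g].
  - move=> x y p q [t Tt /= ->] [s Ts /= ->].
    exists (t * s^-1); first exact: sgenF.
    apply: (@mulIg _ (tf_hom s * cz (ncoc3 f) q)); rewrite mulgVK tf_homM.
    rewrite (gmorphV tf_homM) -!mulgA; congr (_ * _).
    rewrite [in RHS](mulgA (cz _ _)) [cz _ _ * tf_hom s]cz_central.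
    by rewrite -[in RHS]mulgA -czM subrK mulKg.
  - move=> q [t Tt /= e]; have t1 : tf3 t = 1.
      by have /= := congr1 fst e; rewrite mulg1.
    have := congr1 snd e; rewrite mul_cz /= phi0 // add0r; exact: esym.
  - move=> x q [t Tt /= ->]; have [p1 p2] := tfT_pr Tt.
    by split; rewrite mul_cz /=.
  - move=> x y Dx Dy; exists (tfc x.1.1.1 y.1.1.1); first exact: tfTc.
    by rewrite /= mulg1; exact: Tin1.
have Din1 x : D (in1 x) by [].
exists (fun x => chi (in1 x)) => x y.
have := chiM _ _ (Din1 x) (Din1 y).
have -> : in1 x * in1 y = in1 (x * y) * cz (ncoc3 f) (f x y).
  rewrite mul_cz cextM /= /coc3 /= !ncoc11 /alt3 !subr0 !add0r.
  by congr ((_, _, _), _); rewrite mulg1.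
rewrite chiM; [|exact: Din1|by []].
rewrite (chiz (cz (ncoc3 f) (f x y)) (f x y)); last first.
  by exists 1; [exact: sgen1 | rewrite hom1 mul1g].
move=> e; apply/eqP; rewrite addrAC [(_ + chi (in1 x))%R]addrC -e.
by rewrite [(chi _ + _)%R]addrC addrK.
Qed.

End Fixed.
End TFChar.

(** * Commutator covers *)

(** A group M over G with elements lam x y above [~ x, y] that behave as
    commutators of lifts of x and y, although d need not be onto. The operation
    m |-> m * lam (d m) x stands for conjugation by a lift of x; the identities
    [cc_Ml] and [cc_Mr] express the rules for commutators of products through
    this operation. *)
Record commutator_cover (G : finGroupType) (M : groupType) (d : M -> G)
    (lam : G -> G -> M) : Prop := CommutatorCover {
  cc_M : {morph d : m n / m * n};
  cc_lam : forall x y, d (lam x y) = [~ x, y];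
  cc_R : forall m n, [~ m, n] = lam (d m) (d n);
  cc_Ml : forall x y z, lam (x * y) z = lam x z * lam [~ x, z] y * lam y z;
  cc_Mr : forall x y z, lam x (y * z) = lam x z * (lam x y * lam [~ x, y] z);
  cc_V : forall x y, (lam x y)^-1 = lam y x;
  cc_1 : forall x y, commute x y -> lam x y = 1 }.

(** The semidirect product of <[g]> and M, with x acting on M by
    m |-> m * lam (d m) x; the pair (c, m) stands for the product c m. *)
Definition cc_ext (G : finGroupType) (M : groupType) (d : M -> G)
  (lam : G -> G -> M) (H : commutator_cover d lam) (g : G) : Type :=
  (subg_of <[g]> * M)%type.

Section CoverExtension.
Variables (G : finGroupType) (M : groupType) (d : M -> G) (lam : G -> G -> M).
Hypothesis H : commutator_cover d lam.

Definition cc_act (m : M) (x : G) : M := m * lam (d m) x.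

Lemma cc_actM m n x : cc_act (m * n) x = cc_act m x * cc_act n x.
Proof.
rewrite /cc_act (cc_M H) (cc_Ml H) -!mulgA; congr (_ * _); rewrite !mulgA.
congr (_ * _); rewrite [in RHS]commgC (cc_R H) (cc_lam H) -!mulgA //.
Qed.

Lemma cc_dact m x : d (cc_act m x) = d m ^ x.
Proof. by rewrite (cc_M H) (cc_lam H) commgEl mulVKg. Qed.

Lemma cc_act1 m : cc_act m 1 = m.
Proof. by rewrite /cc_act (cc_1 H) ?mulg1 //; exact: commute1. Qed.

Lemma cc_act1g x : cc_act 1 x = 1.
Proof.
rewrite /cc_act (gmorph1 (cc_M H)) (cc_1 H) ?mulg1 //; exact/commute_sym/commute1.
Qed.

Lemma cc_actA m x y : cc_act (cc_act m x) y = cc_act m (x * y).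
Proof.
rewrite /cc_act (cc_M H) (cc_lam H) (cc_Mr H) (cc_Ml H) -!mulgA; congr (_ * _).
rewrite !mulgA; congr (_ * _).
by rewrite [RHS]commgC (cc_R H) !(cc_lam H).
Qed.

Variable g : G.
Local Notation T := (cc_ext H g).
HB.instance Definition _ := Choice.copy T (subg_of <[g]> * M)%type.

Definition cc_mul (u v : T) : T := (u.1 * v.1, cc_act u.2 (sgval v.1) * v.2).
Definition cc_one : T := (1, 1).
Definition cc_inv (u : T) : T := (u.1^-1, cc_act u.2^-1 (sgval u.1)^-1).

Lemma cc_mulA : associative cc_mul.
Proof.
move=> [a m] [b n] [c p]; rewrite /cc_mul /=; congr (_, _); first exact: mulgA.
by rewrite cc_actM cc_actA mulgA.
Qed.
Lemma cc_mul1 : left_id cc_one cc_mul.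
Proof. by move=> [a m]; rewrite /cc_mul /= cc_act1g !mul1g. Qed.
Lemma cc_mulg1 : right_id cc_one cc_mul.
Proof. by move=> [a m]; rewrite /cc_mul /= cc_act1 !mulg1. Qed.
Lemma cc_mulV : left_inverse cc_one cc_inv cc_mul.
Proof.
by move=> [a m]; rewrite /cc_mul /= cc_actA !mulVg cc_act1 mulVg.
Qed.
Lemma cc_mulgV : right_inverse cc_one cc_inv cc_mul.
Proof.
by move=> [a m]; rewrite /cc_mul /= -cc_actM !mulgV cc_act1g.
Qed.
HB.instance Definition _ :=
  isGroup.Build T cc_mulA cc_mul1 cc_mulg1 cc_mulV cc_mulgV.

Definition cc_in (m : M) : T := (1, m).
Definition cc_gen (c : subg_of <[g]>) : T := (c, 1).
Definition cc_extd (u : T) : G := sgval u.1 * d u.2.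
Definition cc_extlam (x y : G) : T := cc_in (lam x y).

Lemma cc_inM : {morph cc_in : m n / m * n}.
Proof. by move=> m n; congr (_, _); rewrite ?mulg1 //= cc_act1. Qed.
Lemma cc_genM : {morph cc_gen : m n / m * n}.
Proof. by move=> m n; congr (_, _); rewrite /= cc_act1g mulg1. Qed.
Lemma cc_split u : u = cc_gen u.1 * cc_in u.2.
Proof. by case: u => c m; congr (_, _); rewrite /= ?cc_act1g ?mulg1 ?mul1g. Qed.
Lemma cc_inJ m c : cc_in m ^ cc_gen c = cc_in (cc_act m (sgval c)).
Proof.
apply: (@mulgI _ (cc_gen c)); rewrite -conjgC.
by congr (_, _); rewrite /= ?cc_act1g ?mulg1 ?mul1g.
Qed.
Lemma cc_extd_in m : cc_extd (cc_in m) = d m.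
Proof. exact: mul1g. Qed.
Lemma cc_extd_gen c : cc_extd (cc_gen c) = sgval c.
Proof. by rewrite /cc_extd /= (gmorph1 (cc_M H)) mulg1. Qed.
Lemma cc_extdM : {morph cc_extd : u v / u * v}.
Proof.
move=> [a m] [b n]; rewrite /cc_extd /= (cc_M H) cc_dact /conjg !mulgA.
by rewrite mulgK.
Qed.

(** The semidirect product is again a commutator cover, now with g in the image.
    The main point is the rule for commutators, which holds for pairs of
    generators and passes to products. *)
Lemma cc_ext_cover : commutator_cover cc_extd cc_extlam.
Proof.
split.
- exact: cc_extdM.
- by move=> x y; rewrite cc_extd_in (cc_lam H).
- pose Q u v := [~ u, v] = cc_extlam (cc_extd u) (cc_extd v).
  have QC u v : Q u v -> Q v u.
    by rewrite /Q => e; rewrite -invgR e -(gmorphV cc_inM) (cc_V H).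
  pose J u := forall x y, cc_extlam x y ^ u =
    cc_extlam x y * cc_extlam [~ x, y] (cc_extd u).
  have Jin m : J (cc_in m).
    move=> x y; rewrite -(gmorphJ cc_inM) -cc_inM cc_extd_in; congr cc_in.
    by rewrite -(cc_lam H) -(cc_R H) commgEl mulVKg.
  have Jgen c : J (cc_gen c).
    by move=> x y; rewrite cc_inJ -cc_inM cc_extd_gen /cc_act (cc_lam H).
  have QM u v w : J v -> Q u w -> Q v w -> Q (u * v) w.
    move=> Jv Qu Qv; rewrite /Q cc_extdM /cc_extlam (cc_Ml H) !cc_inM.
    have -> : [~ u * v, w] = [~ u, w] ^ v * [~ v, w].
      by rewrite /commg /conjg !invgM !mulgA !mulgK.
    by rewrite Qu Qv Jv.
  have Qgg a b : Q (cc_gen a) (cc_gen b).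
    have ab : commute a b.
      apply: subg_inj; apply: (centsP (cycle_abelian g)); exact: subgP.
    rewrite /Q (_ : [~ _, _] = 1); last first.
      by apply/eqP/commgP; rewrite /commute -!cc_genM ab.
    rewrite /cc_extlam !cc_extd_gen (cc_1 H) //; exact: (congr1 sgval ab).
  have Qig m c : Q (cc_in m) (cc_gen c).
    rewrite /Q commgEl cc_inJ /cc_extlam cc_extd_in cc_extd_gen.
    by rewrite -(gmorphV cc_inM) -cc_inM mulKg.
  have Qii m n : Q (cc_in m) (cc_in n).
    by rewrite /Q -(gmorphR cc_inM) /cc_extlam !cc_extd_in (cc_R H).
  have Qs u w : Q (cc_gen u.1) w -> Q (cc_in u.2) w -> Q u w.
    by rewrite {3}[u]cc_split; exact: QM.
  move=> u v; apply: (Qs u v); apply: (QC); apply: (Qs) => //; exact: QC.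
- by move=> x y z; rewrite /cc_extlam (cc_Ml H) !cc_inM.
- by move=> x y z; rewrite /cc_extlam (cc_Mr H) !cc_inM.
- by move=> x y; rewrite /cc_extlam -(gmorphV cc_inM) (cc_V H).
- by move=> x y xy; rewrite /cc_extlam (cc_1 H).
Qed.

End CoverExtension.

Section TGroup.
Variable G : finGroupType.
Local Notation E := (tauflat G).

Definition tfT_pred : {pred E} := fun e => `[< tfT e >].
Lemma tfT_closed : group_closed tfT_pred.
Proof.
split=> [|x y /asboolP Tx /asboolP Ty]; apply/asboolP; [exact: sgen1|exact: sgenF].
Qed.
(** [tfT] as a group. *)
Definition tfTg : Type := {e : E | tfT_pred e}.
HB.instance Definition _ := [isSub of tfTg for @sval _ _].
HB.instance Definition _ := [Choice of tfTg by <:].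
HB.instance Definition _ :=
  SubChoice_isSubGroup.Build E tfT_pred tfTg tfT_closed.

Lemma tfTgP (t : tfTg) : tfT (val t).
Proof. exact: (asboolW (valP t)). Qed.
Definition tfT_in (e : E) (Te : tfT e) : tfTg := Sub e (asboolT Te).

Definition tfTlam (x y : G) : tfTg := tfT_in (tfTc x y).
Definition tfTd (t : tfTg) : G := tf_fold (val t).

Lemma tfT_cover : commutator_cover tfTd tfTlam.
Proof.
have J x y z : tfc x y ^ tfl z = tfc x y * tfc [~ x, y] z.
  have := commg_tfT z (tfTc x y); rewrite tf_fold_c => e.
  by rewrite -(tfcV z) -e invgR commgEl mulVKg.
have JR x y z : tfc x y ^ tfr z = tfc x y * tfc [~ x, y] z.
  by rewrite -tfT_conj_lr ?J //; exact: tfTc.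
split.
- by move=> m n; rewrite /tfTd valM tf_foldM.
- by move=> x y; rewrite /tfTd tf_fold_c.
- move=> m n; apply: val_inj; rewrite (gmorphR (@valM _ _ _)) tfT_commg //; exact: tfTgP.
- move=> x y z; apply: val_inj; rewrite !valM /=; rewrite tfcMl J //.
- move=> x y z; apply: val_inj; rewrite !valM /=; rewrite tfcMr JR //.
- move=> x y; apply: val_inj; rewrite (gmorphV (@valM _ _ _)) /=; exact: tfcV.
- move=> x y xy; apply: val_inj; exact: tfc_commute.
Qed.

(** There is a commutator cover that contains [tfT] and whose image contains any
    given finite list of elements of G. *)
Lemma cover_exists (s : seq G) : exists (M : groupType) (d : M -> G)
    (lam : G -> G -> M) (j : tfTg -> M),
  [/\ commutator_cover d lam, {morph j : x y / x * y}, injective j,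
    (forall t, d (j t) = tf_fold (val t)) /\
    (forall x y, j (tfTlam x y) = lam x y) &
    forall g, g \in s -> exists m, d m = g].
Proof.
elim: s => [|g s [M [d [lam [j [H jM jinj [dj jlam] dsurj]]]]]].
  by exists tfTg, tfTd, tfTlam, id; split=> //; exact: tfT_cover.
exists (cc_ext H g), (@cc_extd _ _ _ _ H g), (@cc_extlam _ _ _ _ H g).
exists (fun t => cc_in H g (j t)); split.
- exact: cc_ext_cover.
- by move=> x y; rewrite jM cc_inM.
- by move=> x y [/jinj].
- by split=> [t|x y]; rewrite ?cc_extd_in ?jlam.
- move=> x; rewrite inE => /predU1P [->|/dsurj [m <-]]; last first.
    by exists (cc_in H g m); rewrite cc_extd_in.
  by exists (cc_gen H (Sub g (cycle_id g))); rewrite cc_extd_gen.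
Qed.

(** The pairing of B with the cocycles that are symmetric on commuting pairs
    separates the elements of B: the cocycle is the image of the factor set of a
    central extension M of G that contains [tfT], under a character of the kernel
    that does not vanish at b. *)
Theorem tfchar_separates (b : E) : tf3 b = 1 -> b != 1 ->
  exists (f : ncocycle G) (phi : E -> QZ),
    [/\ forall x y, commute x y -> f x y = f y x, tfchar f phi & phi b != 0%R].
Proof.
move=> b3 b1; have Tb := tf3_kerT b3.
have [M [d [lam [j [H jM jinj [dj jlam] dsurj]]]]] := cover_exists (enum G).
have dM := cc_M H; have d1 := gmorph1 dM.
have ker_central m n : d m = 1 -> commute m n.
  move=> dm; apply/commgP; rewrite (cc_R H) dm (cc_1 H) //; exact/commute_sym/commute1.
have /choice [s0 s0P] : forall x, exists m, d m = x.
  by move=> x; apply: dsurj; rewrite mem_enum.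
have [s [sP s1]] : exists s : G -> M, (forall x, d (s x) = x) /\ s 1 = 1.
  exists (fun x => if x == 1 then 1 else s0 x).
  by split=> [x|]; [case: eqP => [->|] | rewrite eqxx].
pose D m := d m = 1.
have Dsub : is_subgroup D by exact: subgroup_ker.
pose tb := tfT_in Tb.
have [|||chi chiM chib] := @QZ_separates M D Dsub (j tb).
- by move=> m n Dm _; exact: ker_central.
- by rewrite /D dj /=; case: b3.
- apply: contraNneq b1 => jb; apply/eqP.
  suff -> : b = val (1 : tfTg) by [].
  by rewrite -[b]/(val tb); congr val; apply: jinj; rewrite jb (gmorph1 jM).
(* The factor set of the section s. *)
pose e (x y : G) := s x * s y * (s (x * y))^-1.
have eD x y : D (e x y) by rewrite /D !dM (gmorphV dM) !sP mulgV.
have chi1 : chi 1 = 0%R.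
  by apply: (@addrI _ (chi 1)); rewrite -chiM ?mulg1 ?addr0.
pose f0 (x y : G) := chi (e x y).
have f0P x y z : (f0 x y + f0 (x * y)%g z = f0 y z + f0 x (y * z)%g)%R.
  rewrite /f0 -!chiM //; congr chi.
  have -> : e y z * e x (y * z) = s x * e y z * s (y * z) * (s (x * (y * z)))^-1.
    by rewrite -(ker_central _ (s x) (eD y z)); move: (e y z) => w; rewrite /e !mulgA.
  by rewrite /e !mulgA !mulgVK.
have f01 : f0 1 1 = 0%R by rewrite /f0 /e mulg1 s1 mulg1 mulgV.
pose f := NCocycle f0P f01.
have fsym x y : commute x y -> f x y = f y x.
  move=> xy; rewrite /= /f0 /e xy; congr (chi (_ * _)).
  by apply/commgP; rewrite (cc_R H) !sP (cc_1 H).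
have [phi fphi] := tfchar_exists fsym; exists f, phi; split=> //.
pose W := cext (ncoc3 f).
(* m = (m s(d m)^-1) s(d m) is mapped to the pair with first component d m. *)
pose psi (m : M) : W := ((d m, 1, 1), chi (m * (s (d m))^-1)).
have psiM : {morph psi : m n / m * n}.
  move=> m n; have [e' e'E] : exists e', forall u, e' u = u * (s (d u))^-1.
    by exists (fun u => u * (s (d u))^-1).
  have e'D u : D (e' u) by rewrite /D e'E dM (gmorphV dM) sP mulgV.
  have e'M : e' (m * n) = e' m * e' n * e (d m) (d n).
    rewrite /e !mulgA -[e' m * e' n * s (d m)]mulgA (ker_central _ (s (d m)) (e'D n)).
    by rewrite !e'E dM !mulgA !mulgVK.
  have chie : chi (e' (m * n)) = (chi (e' m) + chi (e' n) + f (d m) (d n))%R.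
    have DM : D (e' m * e' n) by rewrite /D dM !e'D mulg1.
    by rewrite e'M (chiM _ _ DM (eD _ _)) (chiM _ _ (e'D m) (e'D n)).
  rewrite /psi -!e'E chie cextM /= /coc3 /= f01 /alt3 !subr0 dM.
  by congr ((_, _, _), _); rewrite mulg1.
have psis x : (psi (s x)).1 = (x, 1, 1) by rewrite /= sP.
have psij t : tfT t ->
    tfT t /\ forall t' : tfTg, val t' = t -> psi (j t') = tf_hom f phi t.
  have homM := tf_homM fphi.
  move: t; apply: sgen_ind => [|u v [Tu eu] [Tv ev]|u [Tu eu]|_ [x [y ->]]].
  - split=> [|t' t'1]; first exact: sgen1.
    have -> : t' = 1 by exact: val_inj.
    by rewrite (gmorph1 jM) (gmorph1 psiM) (gmorph1 homM).
  - split=> [|t' t'E]; first exact: sgenM.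
    have -> : t' = tfT_in Tu * tfT_in Tv by apply: val_inj; rewrite valM.
    by rewrite jM psiM homM (eu (tfT_in Tu)) // (ev (tfT_in Tv)).
  - split=> [|t' t'E]; first exact: sgenV.
    have -> : t' = (tfT_in Tu)^-1.
      by apply: val_inj; rewrite (gmorphV (@valM _ _ _)).
    by rewrite (gmorphV jM) (gmorphV psiM) (gmorphV homM) (eu (tfT_in Tu)).
  - split=> [|t' t'E]; first exact: tfTc.
    have -> : t' = tfTlam x y by exact: val_inj.
    rewrite jlam -{1}[x]sP -{1}[y]sP -(cc_R H) (gmorphR psiM) tf_hom_c //.
    by apply: cext_commg; rewrite psis.
have [_ /(_ tb erefl) /(congr1 snd) /= <-] := psij b Tb.
by rewrite dj; case: b3 => ->  _ _; rewrite s1 invg1 mulg1.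
Qed.

End TGroup.

(** * Pairings of a finite abelian group with values in Q/Z *)

Section Duality.

Lemma ratQZ_expg (gT : finGroupType) (x : gT) i j :
  ratQZ (i%:R / #[x]%:R)%R = ratQZ (j%:R / #[x]%:R)%R -> x ^+ i = x ^+ j.
Proof.
wlog ij : i j / i <= j => [IH e|].
  by have [/IH->//|/ltnW /IH->] := leqP i j.
move=> /esym/eqP; rewrite -subr_eq0 -raddfB ratQZ_eq0 -mulrBl -natrB // => /intrP [z ez].
have n0 : (#[x]%:R != 0 :> rat)%R by rewrite pnatr_eq0 -lt0n order_gt0.
have e : ((j - i)%:R = z%:~R * #[x]%:R :> rat)%R by rewrite -ez mulfVK.
have {}e : ((j - i)%:Z = z * #[x]%:Z)%R.
  by apply: (@intr_inj rat); rewrite intrM.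
have dv : #[x] %| j - i.
  by have : (#[x]%:Z %| (j - i)%:Z)%Z by rewrite e dvdz_mull.
by rewrite -(subnK ij) expgD (eqP (_ : x ^+ (j - i) == 1)) ?mul1g // -order_dvdn.
Qed.

(** h is a homomorphism to Q/Z on S. *)
Definition is_char (gT : finGroupType) (S : {set gT}) (h : gT -> QZ) : Prop :=
  forall x y, x \in S -> y \in S -> h (x * y) = (h x + h y)%R.

Lemma is_char1 (gT : finGroupType) (S : {group gT}) h : is_char S h -> h 1 = 0%R.
Proof. by move=> hM; apply: (@addrI _ (h 1)); rewrite -hM ?group1 // mulg1 addr0. Qed.
Lemma is_charX (gT : finGroupType) (S : {group gT}) h x n :
  is_char S h -> x \in S -> h (x ^+ n) = (h x *+ n)%R.
Proof.
move=> hM Sx; elim: n => [|n IH]; first by rewrite (is_char1 hM).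
by rewrite expgS hM ?groupX // IH mulrS.
Qed.

(** A natural number i with q = i/n in Q/Z; the default value 0 is used only if
    q is not n-torsion. *)
Definition torsion_log (n : nat) (q : QZ) : nat :=
  if [pick i : 'I_n | q == ratQZ (i%:R / n%:R)%R] is Some i then i else 0.

Lemma torsion_logP n q : 0 < n -> (q *+ n = 0)%R ->
  q = ratQZ ((torsion_log n q)%:R / n%:R)%R.
Proof.
move=> n0 /(QZ_torsion n0) [i lt_i e]; rewrite /torsion_log.
case: pickP => [j /eqP //|/(_ (Ordinal lt_i))]; by rewrite /= e eqxx.
Qed.

(** The dual of a finite abelian group embeds into the group. For a product of
    cyclic groups <[x]> of order n, the character h is sent to the product of the
    x^i with h x = i/n. *)
Lemma dual_embedding (gT : finGroupType) (S : {group gT}) : abelian S ->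
  exists D : (gT -> QZ) -> gT,
  [/\ forall h, D h \in S,
      forall h h', is_char S h -> is_char S h' ->
        D (fun x => h x + h' x)%R = D h * D h' &
      forall h, is_char S h -> D h = 1 -> forall x, x \in S -> h x = 0%R].
Proof.
move=> cS; have [b defS _] := abelian_structure cS.
elim: b S cS defS => [|x b IH] S cS.
  rewrite big_nil => S1; exists (fun=> 1); split=> [h|h h' _ _|h hS _ y].
  - exact: group1.
  - by rewrite mulg1.
  - by rewrite -S1 => /set1P ->; exact: is_char1 hS.
rewrite big_cons => /dprodP [[_ T _ defT] mulS _ tiT]; rewrite defT in mulS tiT.
have sTS : T \subset S by rewrite -mulS mulG_subr.
have Sx : x \in S by rewrite -cycle_subG -mulS mulG_subl.
have [D [DT DM D0]] := IH T (abelianS sTS cS) defT.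
have resT h : is_char S h -> is_char T h.
  by move=> hS y z Ty Tz; apply: hS; exact: (subsetP sTS).
have xlog h : is_char S h -> h x = ratQZ ((torsion_log #[x] (h x))%:R / #[x]%:R)%R.
  move=> hS; apply: torsion_logP; rewrite ?order_gt0 // -(is_charX _ hS) //.
  by rewrite expg_order (is_char1 hS).
exists (fun h => x ^+ torsion_log #[x] (h x) * D h); split=> [h|h h' hS h'S|h hS].
- by rewrite groupM ?groupX // (subsetP sTS).
- rewrite DM; try exact: resT.
  have hhS : is_char S (fun y => h y + h' y)%R.
    by move=> y z Sy Sz; rewrite hS // h'S // addrACA.
  have -> : x ^+ torsion_log #[x] (h x + h' x)%R =
      x ^+ torsion_log #[x] (h x) * x ^+ torsion_log #[x] (h' x).
    rewrite -expgD; apply: ratQZ_expg.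
    by rewrite -(xlog _ hhS) natrD mulrDl raddfD /= -!xlog.
  rewrite -!mulgA; congr (_ * _); rewrite !mulgA; congr (_ * _).
  by apply: (centsP cS); rewrite ?groupX // (subsetP sTS).
- move=> e; have Tx : x ^+ torsion_log #[x] (h x) \in T.
    by rewrite -(groupMr _ (DT h)) e group1.
  have x1 : x ^+ torsion_log #[x] (h x) = 1.
    have : x ^+ torsion_log #[x] (h x) \in <[x]> :&: T by rewrite inE mem_cycle.
    by rewrite tiT => /set1P.
  have hx0 : h x = 0%R.
    rewrite (xlog h hS); apply/eqP; rewrite ratQZ_eq0.
    move/eqP: x1; rewrite -order_dvdn => /dvdnP [k ->].
    by rewrite natrM mulfK ?rpred_nat // pnatr_eq0 -lt0n order_gt0.
  rewrite x1 mul1g in e.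
  move=> y; rewrite -mulS => /mulsgP [_ t /cycleP [i ->] Tt ->].
  rewrite hS ?groupX //; last exact: (subsetP sTS).
  rewrite (is_charX _ hS) // hx0 mul0rn add0r.
  exact: (D0 h (resT h hS) e).
Qed.

End Duality.

(** A Z-module all of whose elements occur in a list s, as a finite group. *)
Definition finZ (A : zmodType) (s : seq A) (sA : forall a, a \in s) : Type := A.

Section FinZ.
Variables (A : zmodType) (s : seq A) (sA : forall a, a \in s).
Local Notation T := (finZ sA).
HB.instance Definition _ := GRing.Zmodule.copy T A.
Let finZ_can : cancel (fun a : T => index a s) (fun n => nth 0%R s n).
Proof. by move=> a; rewrite nth_index. Qed.
HB.instance Definition _ := CanIsCountable finZ_can.
Let finZ_enum : Finite.axiom (undup s : seq T).
Proof. by move=> a; rewrite count_uniq_mem ?undup_uniq // mem_undup sA. Qed.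
HB.instance Definition _ := isFinite.Build T finZ_enum.
HB.instance Definition _ := [finGroupMixin of T for +%R].
End FinZ.

(** A nondegenerate pairing of a finite A and a subgroup B of E gives an
    isomorphism of A and B. Both B -> Hom(A, Q/Z) -> A and
    A -> Hom(B, Q/Z) -> B are injective, hence bijective. *)
Theorem finite_pairing_iso (A : zmodType) (s : seq A) (E : groupType)
    (B : E -> Prop) (beta : A -> E -> QZ) :
  (forall a, a \in s) -> is_subgroup B ->
  (forall a b b', B b -> B b' -> beta a (b * b') = (beta a b + beta a b')%R) ->
  (forall a a' b, B b -> beta (a + a')%R b = (beta a b + beta a' b)%R) ->
  (forall a, (forall b, B b -> beta a b = 0%R) -> a = 0%R) ->
  (forall b, B b -> b != 1 -> exists a, beta a b != 0%R) ->
  exists i : A -> E, [/\ {morph i : a a' / (a + a')%R >-> a * a'},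
    injective i & forall e, B e <-> exists a, i a = e].
Proof.
move=> sA Bsub betaM betaD beta_nd beta_sep.
pose gT : finGroupType := finZ sA.
have abT (S : {group gT}) : abelian S.
  by apply/centsP => x _ y _; exact: (addrC (x : A) y).
have [D [_ DM D0]] := dual_embedding (abT [group of [set: gT]]).
have B1 : B 1 := Bsub.1.
have BF e e' : B e -> B e' -> B (e * e'^-1) by exact: Bsub.2.
have BV e : B e -> B e^-1 by move=> Be; rewrite -[e^-1]mul1g; exact: BF.
have BM e e' : B e -> B e' -> B (e * e').
  by move=> Be Be'; rewrite -[e']invgK; exact/BF/BV.
pose u (e : E) : gT := D (fun a : gT => beta a e).
have charb e : B e -> is_char [set: gT] (fun a : gT => beta a e).
  by move=> Be a a' _ _; exact: betaD.
have uM e e' : B e -> B e' -> u (e * e') = u e * u e'.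
  move=> Be Be'; rewrite /u -DM; try exact: charb.
  by congr D; apply: funext => a; exact: betaM.
have u1 e : B e -> u e = 1 -> e = 1.
  move=> Be ue; apply/eqP; apply: contraT => /(beta_sep _ Be) [a].
  by rewrite (D0 _ (charb e Be) ue a) ?inE ?eqxx.
have uinj e e' : B e -> B e' -> u e = u e' -> e = e'.
  move=> Be Be' ee'; apply: divg1_eq; apply: u1; first exact: BF.
  by apply: (@mulIg _ (u e')); rewrite -uM ?mul1g; [rewrite mulgVK|exact: BF|].
(* S is the image of the embedding u of B in A, and v is the inverse of u. *)
pose Sset := [set a : gT | `[< exists2 e, B e & u e = a >]].
have Sgroup : group_set Sset.
  apply/group_setP; split=> [|a a'].
    rewrite inE; apply/asboolP; exists 1 => //.
    by apply: (@mulgI _ (u 1)); rewrite -uM // !mulg1.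
  rewrite !inE => /asboolP [e Be <-] /asboolP [e' Be' <-]; apply/asboolP.
  by exists (e * e'); [exact: BM | rewrite uM].
pose S := Group Sgroup.
have /choice [v vP] : forall a : gT, exists e, B e /\ (a \in S -> u e = a).
  move=> a; have [|_] := boolP (a \in S); last by exists 1.
  by rewrite inE => /asboolP [e Be ue]; exists e.
have vB a : B (v a) by have [] := vP a.
have vK a : a \in S -> u (v a) = a by have [] := vP a.
have uS e : B e -> u e \in S by move=> Be; rewrite inE; apply/asboolP; exists e.
have uK e : B e -> v (u e) = e.
  by move=> Be; apply: uinj; rewrite ?vK ?uS.
have vM a a' : a \in S -> a' \in S -> v (a * a') = v a * v a'.
  move=> Sa Sa'; apply: uinj => //; first exact: BM.
  by rewrite uM ?vK ?groupM.
have [D' [D'S D'M D'0]] := dual_embedding (abT S).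
pose w (a : gT) : gT := D' (fun t => beta a (v t)).
have charw a : is_char S (fun t => beta a (v t)).
  by move=> t t' St St'; rewrite vM // betaM.
have wM (a a' : gT) : w (a * a') = w a * w a'.
  rewrite /w -D'M //; congr D'; apply: funext => t; exact: betaD.
have w1 a : w a = 1 -> a = 0%R.
  move=> wa; apply: beta_nd => e Be.
  by rewrite -(uK e Be); exact: (D'0 _ (charw a) wa _ (uS e Be)).
have winj : injective w.
  move=> a a' e; have w0 : w 1 = 1 by apply: (@mulgI _ (w 1)); rewrite -wM !mulg1.
  have /w1/eqP : w (a * a'^-1) = 1.
    by apply: (@mulIg _ (w a')); rewrite -wM mulgVK mul1g.
  by rewrite (subr_eq0 (a : A) a') => /eqP.
exists (fun a => v (w a)); split=> [a a'|a a' /(congr1 u)|e].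
- by rewrite -vM ?D'S // -wM.
- by rewrite !vK ?D'S // => /winj.
- split=> [Be|[a <-]] //.
  exists (invF winj (u e)); by rewrite f_invF uK.
Qed.

(** * The pairing with the Bogomolov multiplier *)

Section Cocycles.
Variable G : finGroupType.
Local Notation E := (tauflat G).

Lemma Z2P (f : Z2 G) x y z :
  (val f (x, y) + val f ((x * y)%g, z) = val f (y, z) + val f (x, (y * z)%g))%R.
Proof.
have /'forall_'forall_'forall_eqP/(_ x y z)/eqP := valP f.
by rewrite subr_eq0 => /eqP <-; rewrite addrAC subrK.
Qed.

(** Subtraction of the coboundary of a constant makes a cocycle vanish at
    (1, 1). *)
Definition normalize (f : Z2 G) (x y : G) : QZ := (val f (x, y) - val f (1%g, 1%g))%R.

Lemma normalizeP f x y z : (normalize f x y + normalize f (x * y)%g z =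
  normalize f y z + normalize f x (y * z)%g)%R.
Proof. by rewrite /normalize addrACA Z2P addrACA. Qed.
Lemma normalize11 f : normalize f 1 1 = 0%R.
Proof. exact: subrr. Qed.
Definition normalized f : ncocycle G := NCocycle (normalizeP f) (normalize11 f).

Lemma normalizeD f g x y :
  normalize (f + g)%R x y = (normalize f x y + normalize g x y)%R.
Proof.
have e u : val (f + g)%R u = (val f u + val g u)%R by rewrite raddfD ffunE.
by rewrite /normalize !e opprD addrACA.
Qed.

Lemma coboundaryP (f : Z2 G) : reflect
  (exists c : G -> QZ, forall x y, val f (x, y) = (c y - c (x * y)%g + c x)%R)
  (f \in coboundary (G := G)).
Proof. exact: asboolP. Qed.

Lemma normalize_cohomologous f g : H2class f = H2class g ->
  exists2 c : G -> QZ, c 1 = 0%R &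
    forall x y, normalize f x y = (normalize g x y + (c y - c (x * y)%g + c x))%R.
Proof.
move=> /H2class_eq /coboundaryP [c cP].
have e x y : val f (x, y) = (val g (x, y) + (c y - c (x * y)%g + c x))%R.
  by rewrite -cP raddfB !ffunE addrC subrK.
exists (fun x => c x - c 1%g)%R => [|x y]; first exact: subrr.
rewrite /normalize !e mulg1 subrr add0r opprD addrACA; congr (_ + _)%R.
by rewrite addrA opprB addrA subrK.
Qed.

(** On the kernel of [tf3], phi depends only on the cohomology class. *)
Lemma tfchar_cohomologous f g phi psi b : H2class f = H2class g ->
  tfchar (normalize f) phi -> tfchar (normalize g) psi -> tf3 b = 1 -> phi b = psi b.
Proof.
move=> /normalize_cohomologous [c c1 fg] fphi gpsi [b1 b2 b3].
have := tfchar_add gpsi (tfchar_coboundary c1).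
have -> : (fun x y => normalize g x y + (c y - c (x * y)%g + c x))%R = normalize f.
  by apply: funext => x; apply: funext => y.
move=> /(tfchar_uniq fphi) ->.
by rewrite b1 b2 b3 c1 /alt3 !subr0.
Qed.

Lemma coboundary_shift (p q r k : QZ) :
  (p - q + r + k = (p + k) - (q + k) + (r + k))%R.
Proof. by rewrite opprD [(p + k + _)%R]addrACA subrr addr0 addrA. Qed.

(** The class of f is in the Bogomolov multiplier if and only if f is symmetric on
    commuting pairs. *)
Lemma bogomolov_sym (f : Z2 G) :
  H2class f \in bogomolov (G := G) <->
  (forall x y, commute x y -> normalize f x y = normalize f y x).
Proof.
split=> [/'forall_implyP B x y xy|fsym].
  pose A := <<[set x; y]>>%G.
  have cA : abelian A.
    rewrite abelian_gen abelianE; apply/centsP=> u /set2P [] -> v /set2P [] -> //.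
  have := B A cA; rewrite resE => /eqP.
  rewrite -[0%R](raddf0 (@H2class (subg_of A))) => /H2class_eq.
  rewrite subr0 => /asboolP [c cP].
  have Ax : x \in A by rewrite mem_gen // !inE eqxx.
  have Ay : y \in A by rewrite mem_gen // !inE eqxx orbT.
  have := cP (subg A x) (subg A y); have := cP (subg A y) (subg A x).
  rewrite !ffunE /= !subgK // /normalize => -> ->; congr (_ - _)%R.
  have -> : subg A x * subg A y = subg A y * subg A x.
    by apply: val_inj; rewrite /= !subgK.
  by rewrite addrAC [RHS]addrAC [(c _ + c _)%R]addrC.
apply/'forall_implyP => A cA; rewrite resE.
have [|c cP] := @symmetric_cocycle_split _ (normalized f) _ cA.
  by move=> x y Ax Ay; apply: fsym; exact: (centsP cA).
apply/eqP; rewrite -[0%R](raddf0 (@H2class (subg_of A))); apply/H2class_eq.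
rewrite subr0; apply/asboolP.
exists (fun u => c (sgval u) + val f (1%g, 1%g))%R => u v.
rewrite ffunE /=; have := cP _ _ (subgP u) (subgP v); rewrite /= /normalize.
move=> /eqP; rewrite subr_eq => /eqP ->.
exact: coboundary_shift.
Qed.

(** The nondegenerate pairing of the Bogomolov multiplier and the kernel of
    [tf3]. *)
Theorem bogomolov_pairing : exists beta : B0 G -> E -> QZ,
  [/\ forall a b b', tf3 b = 1 -> tf3 b' = 1 ->
        beta a (b * b') = (beta a b + beta a b')%R,
      forall a a' b, tf3 b = 1 -> beta (a + a')%R b = (beta a b + beta a' b)%R,
      forall a, (forall b, tf3 b = 1 -> beta a b = 0%R) -> a = 0%R &
      forall b, tf3 b = 1 -> b != 1 -> exists a, beta a b != 0%R].
Proof.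
pose rp (a : B0 G) : Z2 G := generic_quotient.repr (val a).
have rpK a : H2class (rp a) = val a by exact: H2class_repr.
have rpsym a x y : commute x y -> normalized (rp a) x y = normalized (rp a) y x.
  by move: x y; apply/bogomolov_sym; rewrite rpK; exact: (valP a).
have /choice [beta betaP] : forall a, exists phi, tfchar (normalized (rp a)) phi.
  by move=> a; exact: tfchar_exists (rpsym a).
exists beta; split=> [a b b' b1 b'1|a a' b b1|a a0|b b1 bn1].
- by have [_ _ ->] := betaP a; rewrite b1 b'1 (coc311 (normalized (rp a))) addr0.
- have := tfchar_add (betaP a) (betaP a').
  have -> : (fun x y => normalize (rp a) x y + normalize (rp a') x y)%R =
      normalize (rp a + rp a')%R.
    by apply: funext => x; apply: funext => y; rewrite normalizeD.
  move=> h; rewrite (tfchar_cohomologous _ (betaP (a + a')%R) h b1) //.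
  by rewrite rpK !raddfD /= !rpK.
- have [c cP] := tfchar_ker_split (rpsym a) (betaP a) a0.
  apply: val_inj; rewrite -rpK raddf0 -(raddf0 (@H2class G)); apply/H2class_eq.
  rewrite subr0; apply/coboundaryP.
  exists (fun x => c x + val (rp a) (1%g, 1%g))%R => x y.
  have := cP x y; rewrite /= /normalize => /eqP; rewrite subr_eq => /eqP ->.
  exact: coboundary_shift.
- have [f [phi [fsym fphi phib]]] := tfchar_separates b1 bn1.
  have fZ : cocycle [ffun u => f u.1 u.2].
    apply/'forall_'forall_'forall_eqP => x y z; rewrite !ffunE /=.
    by rewrite [(_ - _ + _)%R]addrAC -ncocP addrK subrr.
  pose F : Z2 G := Sub _ fZ.
  have FE : normalize F = f.
    apply: funext => x; apply: funext => y.
    by rewrite /normalize !ffunE /= ncoc11 subr0.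
  have FB : H2class F \in bogomolov (G := G) by apply/bogomolov_sym; rewrite FE.
  exists (Sub (H2class F) FB).
  rewrite (@tfchar_cohomologous _ F _ phi _ _ (betaP _)) ?FE //.
Qed.

Lemma coboundary_cocycle (c : G -> QZ) :
  cocycle [ffun u : G * G => (c u.2 - c (u.1 * u.2)%g + c u.1)%R].
Proof.
apply/'forall_'forall_'forall_eqP => x y z; rewrite !ffunE /= mulgA.
move: (c z) (c (y * z)) (c y) (c (x * y * z)) (c (x * y)) (c x) => p q r s t u.
rewrite !opprD !opprK !addrA.
rewrite (ACl ((1*4)*(2*7)*(3*10)*(5*8)*(6*11)*(9*12)))%AC /=.
by rewrite !(subrr, addNr, addr0).
Qed.

(** The norm argument: |G| f is the coboundary of the sums S x of f (x, z) over z,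
    which are divisible by |G|. *)
Lemma cocycle_norm (f : Z2 G) : exists c : G -> QZ, forall x y,
  (val f (x, y) *+ #|G| = (c y - c (x * y)%g + c x) *+ #|G|)%R.
Proof.
pose S x := (\sum_(z : G) val f (x, z))%R.
have SE x y : (val f (x, y) *+ #|G| = S y - S (x * y)%g + S x)%R.
  have -> : S x = (\sum_(z : G) val f (x, y * z)%g)%R.
    by rewrite /S (reindex_inj (mulgI y)).
  rewrite /S -sumrB -big_split /= -sumr_const; apply: eq_bigr => z _.
  by rewrite addrAC -Z2P addrK.
have /choice [c cP] : forall x, exists c, (c *+ #|G| = S x)%R.
  by move=> x; apply: QZ_divisible; apply/card_gt0P; exists 1.
by exists c => x y; rewrite mulrnDl mulrnBl !cP SE.
Qed.

(** Each class has a cocycle with values in the |G|-torsion of Q/Z. *)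
Lemma H2_finite : exists s : seq (H2 G), forall c, c \in s.
Proof.
pose F (h : {ffun G * G -> 'I_#|G|}) : {ffun G * G -> QZ} :=
  [ffun u => ratQZ ((h u)%:R / #|G|%:R)%R].
exists [seq H2class (insubd (0%R : Z2 G) (F h)) | h : {ffun G * G -> 'I_#|G|}] => a.
have n0 : 0 < #|G| by apply/card_gt0P; exists 1.
rewrite -(H2class_repr a); move: (generic_quotient.repr a) => f.
have [c cP] := cocycle_norm f.
pose g : Z2 G := (f - Sub _ (coboundary_cocycle c))%R.
have gE x y : val g (x, y) = (val f (x, y) - (c y - c (x * y)%g + c x))%R.
  by rewrite raddfB !ffunE.
have fg : H2class f = H2class g.
  apply/H2class_eq/coboundaryP; exists c => x y.
  by rewrite opprB addrCA subrr addr0 SubK ffunE.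
have /choice [h hP] : forall u : G * G, exists i : 'I_#|G|,
    val g u = ratQZ (i%:R / #|G|%:R)%R.
  move=> [x y]; have [||i lt_i e] := @QZ_torsion #|G| (val g (x, y)) => //.
    by rewrite gE mulrnBl cP subrr.
  by exists (Ordinal lt_i).
rewrite fg; apply/imageP; exists (finfun h) => //; congr H2class.
apply: val_inj; have -> : F (finfun h) = val g.
  by apply/ffunP => u; rewrite hP ffunE ffunE.
by rewrite insubdK //; exact: (valP g).
Qed.

Lemma B0_finite : exists s : seq (B0 G), forall a, a \in s.
Proof.
have [s sP] := H2_finite; exists (pmap insub s) => a.
by rewrite mem_pmap_sub.
Qed.

(** * The map onto K(G, 3) *)

Section KMap.
Variable alpha : {perm G}.
Hypothesis alphaAI : AI_automorphism alpha.

Lemma AI_M : {morph alpha : x y / x * y}.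
Proof.
move=> x y; case: alphaAI => Aa _.
by have /morphicP h := Aut_morphic Aa; rewrite h ?inE.
Qed.

Lemma AI_mul (x : G) : x * alpha x \in [set: G]^`(1).
Proof.
have nD (y : G) : y \in 'N([set: G]^`(1)).
  by apply: (subsetP (normal_norm (der_normal 1 [set: G]))); rewrite inE.
by apply: coset_idr => //; rewrite morphM //= alphaAI.2 mulgV.
Qed.

(** The coordinates of the map to K(G, 3). *)
Definition K_coord (e : E) : {ffun 'I_3 -> G} :=
  [ffun i : 'I_3 => nth 1 [:: tf_pr1 e; tf_pr2 e; alpha (tf_fold e)] i].

Lemma K_coordM : {morph K_coord : e e' / e * e'}.
Proof.
move=> e e'; apply/ffunP => i; rewrite !ffunE tf_pr1M tf_pr2M tf_foldM AI_M.
by case: i => [[|[|[|]]]].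
Qed.

Lemma prod_ord3 (F : 'I_3 -> G) :
  \prod_(i < 3) F i = F (inord 0) * F (inord 1) * F (inord 2).
Proof.
rewrite 3!big_ord_recl big_ord0 mulg1 mulgA.
by congr (F _ * F _ * F _); apply: val_inj; rewrite /= inordK.
Qed.

Lemma K_coord_prod e : \prod_(i < 3) K_coord e i =
  tf_pr1 e * tf_pr2 e * alpha (tf_fold e).
Proof. by rewrite prod_ord3 !ffunE !inordK. Qed.

Lemma K_coord_inK e : inK (K_coord e).
Proof.
have Kl a : K_coord (tfl a) \in @inK G 3.
  by rewrite inE K_coord_prod tf_pr1_l tf_pr2_l tf_fold_l mulg1 AI_mul.
have Kr a : K_coord (tfr a) \in @inK G 3.
  by rewrite inE K_coord_prod tf_pr1_r tf_pr2_r tf_fold_r mul1g AI_mul.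
have KM := group_closedM (inK_group_closed G 3).
suff : K_coord e \in @inK G 3 by [].
elim/tauflat_ind: e => [|a u IH|b u IH].
- by rewrite (gmorph1 K_coordM); exact: (inK_group_closed G 3).1.
- by rewrite K_coordM KM.
- by rewrite K_coordM KM.
Qed.

Definition K_map (e : E) : K G 3 := Sub (K_coord e) (K_coord_inK e).

Lemma K_mapM : {morph K_map : e e' / e * e'}.
Proof. by move=> e e'; apply: val_inj; rewrite valM; exact: K_coordM. Qed.

Lemma K_map_ker e : K_map e = 1 <-> tf3 e = 1.
Proof.
have a1 : alpha 1 = 1 := gmorph1 AI_M.
split=> [/(congr1 val) /ffunP h|[h0 h1 h2]].
  have := h (inord 0); have := h (inord 1); have := h (inord 2).
  rewrite !ffunE !inordK //= -{1}a1 => /perm_inj e0 e2 e1.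
  by congr (_, _, _).
apply: val_inj; rewrite val1; apply/ffunP => i.
by rewrite /= !ffunE h0 h1 h2 a1; case: i => [[|[|[|]]]].
Qed.

Lemma tfT_onto_der w : w \in [set: G]^`(1) ->
  exists2 t, tfT t & alpha (tf_fold t) = w.
Proof.
pose Q := [set w | `[< exists2 t, tfT t & alpha (tf_fold t) = w >]].
have Qg : group_set Q.
  apply/group_setP; split=> [|x y].
    rewrite inE; apply/asboolP; exists 1; first exact: sgen1.
    by rewrite (gmorph1 (@tf_foldM G)) (gmorph1 AI_M).
  rewrite !inE => /asboolP [t Tt <-] /asboolP [s Ts <-]; apply/asboolP.
  by exists (t * s); [exact: sgenM | rewrite tf_foldM AI_M].
move=> Gw; suff : w \in Group Qg by rewrite inE => /asboolP.
move: w Gw; apply/subsetP; rewrite derg1 gen_subG.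
apply/subsetP => _ /imset2P [x y _ _ ->]; rewrite inE; apply/asboolP.
exists (tfc (alpha^-1 x) (alpha^-1 y)); first exact: tfTc.
by rewrite tf_fold_c (gmorphR AI_M) !permKV.
Qed.

Lemma K_map_surj q : exists e, K_map e = q.
Proof.
pose x := val q (inord 0); pose y := val q (inord 1); pose z := val q (inord 2).
have xyz : x * y * z \in [set: G]^`(1).
  by have : inK (val q) := valP q; rewrite /inK /= prod_ord3.
have : (alpha (x * y))^-1 * z \in [set: G]^`(1).
  have := groupM (groupVr (AI_mul (x * y))) xyz.
  by rewrite invgM -!mulgA (mulgA x) mulKg.
move=> /tfT_onto_der [t Tt tE]; have [t1 t2] := tfT_pr Tt.
exists (tfl x * tfr y * t); apply: val_inj; apply/ffunP => i.
rewrite /= ffunE !tf_pr1M !tf_pr2M !tf_foldM tf_pr1_l tf_pr1_r tf_pr2_l tf_pr2_r.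
rewrite tf_fold_l tf_fold_r t1 t2 !mulg1 mul1g [alpha (_ * tf_fold t)]AI_M tE mulKVg.
have -> : i = inord i by rewrite inord_val.
by case: i => [[|[|[|]]]] //= _; rewrite inordK.
Qed.

End KMap.

End Cocycles.

Theorem corollary6p1 (G : finGroupType) :
  (exists alpha : {perm G}, AI_automorphism alpha) ->
  exists (i : B0 G -> tauflat G) (p : tauflat G -> K G 3),
    central_extension i p.
Proof.
move=> [alpha alphaAI].
have [beta [betaM betaD beta_nd beta_sep]] := bogomolov_pairing G.
have [s sP] := B0_finite G.
have kerB := subgroup_ker (@tf3M G).
have [i [iM iinj iP]] :=
  finite_pairing_iso sP kerB betaM betaD beta_nd beta_sep.
exists i, (K_map alphaAI); split=> // [||e|a e].
- exact: K_mapM.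
- exact: K_map_surj.
- by rewrite K_map_ker.
- by apply: tf3_ker_central; apply/iP; exists a.
Qed.
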